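(* Let $H\in(0,1)\setminus\{1/2\}$, $p=1/H$, $\kappa_H:=\min\{1,2-2H\}$, and let $\pi=(\pi_n)_{n\ge1}$ be a fixed deterministic sequence of finite partitions of $[0,1]$ with $$\operatorname{mesh}(\pi_n)=o\bigl((\log n)^{-1/\kappa_H}\bigr)\qquad(n\to\infty).$$ Let $X^H$ be the random signed Takagi--Landsberg bridge of index $H$ and $L_H$ its uniform Hölder constant. Then there is a constant $c_H>0$, depending only on $H$, such that for all sufficiently large $n$, $$c_H\le\mathbb E\,[X^H]^{(p)}_{(\pi_n)}\le L_H^{\,p},$$ and $$[X^H]^{(p)}_{(\pi_n)}-\mathbb E\,[X^H]^{(p)}_{(\pi_n)}\longrightarrow0\qquad\text{almost surely}.$$ In particular, almost surely, $$c_H\le\liminf_{n\to\infty}[X^H]^{(p)}_{(\pi_n)}\le\limsup_{n\to\infty}[X^H]^{(p)}_{(\pi_n)}\le L_H^{\,p},$$ and $p^\pi(X^H)=1/H$.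
   Context: Faber--Schauder functions: for $n\ge0$ and $0\le k<2^n$, $e_{n,k}(t)=2^{-n/2}e_{0,0}(2^nt-k)$, where $e_{0,0}(u)=\max\{0,\min(u,1-u)\}$. Let $\{\theta_{n,k}\}$ be independent Rademacher random variables ($\pm1$ with probability $1/2$ each). For $H\in(0,1)$ the random signed Takagi--Landsberg bridge of index $H$ is $$X^H_t=\sum_{n=0}^\infty2^{n(1/2-H)}\sum_{k=0}^{2^n-1}\theta_{n,k}e_{n,k}(t),\qquad0\le t\le1,$$ where the series converges uniformly for every choice of signs. $L_H$ denotes a fixed finite constant, depending only on $H$ and not on the sign array, such that $|X^H_t-X^H_s|\le L_H|t-s|^H$ for all $s,t\in[0,1]$ and every choice of the signs (such a constant exists). For a finite partition $\tau=\{0=t_0<\cdots<t_N=1\}$, $\operatorname{mesh}(\tau)=\max_i(t_{i+1}-t_i)$; for continuous $x$ and $q\ge1$, $[x]^{(q)}_{(\tau)}=\sum_{i=0}^{N-1}|x(t_{i+1})-x(t_i)|^q$. Deterministic means that the partition points do not depend on the signs. The variation index of $x\in C([0,1])$ along $\pi$ is $$p^\pi(x):=\inf\left\{q\ge1:\limsup_{n\to\infty}[x]^{(q)}_{(\pi_n)}=0\right\},\qquad\inf\varnothing=\infty .$$ *)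

(* Defs.v *)
From HB Require Import structures.
From mathcomp Require Import all_boot all_order all_algebra.
From mathcomp Require Import all_classical all_reals all_analysis.

Set Implicit Arguments.
Unset Strict Implicit.
Unset Printing Implicit Defensive.

Import Order.TTheory GRing.Theory Num.Theory.
Import numFieldNormedType.Exports.

Local Open Scope classical_set_scope.
Local Open Scope ring_scope.

Section faber_schauder.
Context {R : realType}.

Definition faber_schauder00 (u : R) : R := Num.max 0 (Num.min u (1 - u)).

Definition faber_schauder (n k : nat) (t : R) : R :=
  2 `^ (- (n%:R / 2)) * faber_schauder00 (2 ^+ n * t - k%:R).

Definition dyadic_array (T : Type) := forall n : nat, 'I_(2 ^ n) -> T.

Definition is_sign_array (theta : dyadic_array R) : Prop :=
  forall n (k : 'I_(2 ^ n)), theta n k = 1 \/ theta n k = -1.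

Definition takagi_landsberg (H : R) (theta : dyadic_array R) (t : R) : R :=
  limn (series (fun n => 2 `^ (n%:R * (2^-1 - H)) *
    \sum_(k < 2 ^ n) theta n k * faber_schauder n k t)).

Definition uniform_holder_constant (H L : R) : Prop :=
  forall theta : dyadic_array R, is_sign_array theta ->
  forall s t : R, 0 <= s <= 1 -> 0 <= t <= 1 ->
    `|takagi_landsberg H theta t - takagi_landsberg H theta s|
      <= L * `|t - s| `^ H.

End faber_schauder.

Section partitions.
Context {R : realType}.

(* As for the library's [itv_partition] and [variation], a partition
   0 = t_0 < ... < t_N = 1 is the sequence s = [:: t_1; ...; t_N]. *)
Definition partition_pt (s : seq R) (i : nat) : R := nth 1 (0 :: s) i.

Definition mesh (s : seq R) : R :=
  \big[Num.max/0]_(0 <= i < size s) (partition_pt s i.+1 - partition_pt s i).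

Definition power_variation (q : R) (x : R -> R) (s : seq R) : R :=
  \sum_(0 <= i < size s)
    `|x (partition_pt s i.+1) - x (partition_pt s i)| `^ q.

(* [ereal_inf set0 = +oo] *)
Definition variation_index (pi : nat -> seq R) (x : R -> R) : \bar R :=
  ereal_inf [set q%:E | q in
    [set q : R | 1 <= q /\
      limn_esup (fun n => (power_variation q x (pi n))%:E) = 0%E]].

End partitions.

Section rademacher.
Context {d : measure_display} {T : measurableType d} {R : realType}
  (P : probability T R).

Definition is_rademacher (X : {RV P >-> R}) : Prop :=
  P (X @^-1` [set 1]) = (2^-1)%:E /\ P (X @^-1` [set -1]) = (2^-1)%:E.

Definition mutually_independent (I : eqType) (X : I -> {RV P >-> R}) : Prop :=
  forall (J : seq I) (B : I -> set R), uniq J ->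
    (forall i, measurable (B i)) ->
    P (\bigcap_(i in [set` J]) X i @^-1` B i)
      = (\prod_(i <- J) P (X i @^-1` B i))%E.

Definition independent_rademacher_array
    (theta : dyadic_array {RV P >-> R}) : Prop :=
  (forall n (k : 'I_(2 ^ n)), is_rademacher (theta n k)) /\
  mutually_independent
    (fun i : {n : nat & 'I_(2 ^ n)} => theta (tag i) (tagged i)).

Definition random_takagi_landsberg (H : R)
    (theta : dyadic_array {RV P >-> R}) (w : T) (t : R) : R :=
  takagi_landsberg H (fun n k => theta n k w) t.

End rademacher.

(* Main.v *)
Require Import Defs.
From HB Require Import structures.
From mathcomp Require Import all_boot all_order all_algebra.
From mathcomp Require Import all_classical all_reals all_analysis.
From mathcomp Require Import measurable_realfun.
From mathcomp Require Import ring lra.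

(** Write r = 2^(-H), phi for the tent function faber_schauder00 and
    hat (m, k) t = r^m phi(2^m t - k), so that
    X_t = sum over the nodes (m, k) of theta_(m,k) * hat (m, k) t.  For a
    partition with steps d_i and mesh h let V be its p-th variation, p = 1/H.

    Upper bounds.  By the Holder property every increment satisfies
    |X_(t_(i+1)) - X_(t_i)|^p <= L^p d_i, and the steps sum to 1.

    Lower bound for the mean.  For each step there is a node j, at a dyadic scale
    comparable to d_i, whose hat changes by at least d_i^H / 16 over the step
    (exists_large_coefficient).  Averaging over the sign of j alone,
    (|y + a|^p + |y - a|^p) / 2 >= |a|^p / 2 whatever the other signs are, so
    E |X_(t_(i+1)) - X_(t_i)|^p >= 16^(-p) d_i / 2
    (sign_mean_power_variation_ge).

    Concentration.  Flipping the sign of the node j changes V by at most a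
    constant times I_j = sum_i d_i^(1-H) |hat j t_(i+1) - hat j t_i|, by the mean
    value inequality for the p-th power and H (p - 1) = 1 - H.  The squares are
    summed as (sup of I_j over level m) times (sum of I_j over level m).  The total
    variation of a hat of level m is r^m, so the first factor is at most
    h^(1-H) r^m; at most two hats of a level are nonzero at the two endpoints of a
    step, so the second is at most 2 r^m sum_i d_i^(1-H) min(1, 2^m d_i).  The
    geometric sum over m is of order d_i^min(1, 2H) (level_sum_le; here H = 1/2
    would produce a logarithm), and altogether sum_j I_j^2 <= C h^kappa
    (sum_influence_sq_le).  The bounded difference inequality
    (two_sided_tail_le) gives
    P (|V - E V| >= t) <= 2 exp (- t^2 / (2 C' h^kappa)), which under the mesh
    condition is eventually at most 2 / n^2; Borel-Cantelli (ae_near_notin)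
    concludes.

    These arguments are carried out for the partial sums of the series, whose
    variation depends on finitely many signs: an expectation is then a finite
    average, written recursively as sign_mean.  Each partial sum is the mean of two
    full series, the second one with all later signs flipped, so it inherits the
    Holder constant L (partial_tl_holder); and for a fixed partition the variation
    of the partial sums converges to V uniformly in the signs
    (power_variation_truncation_le).

    Variation index.  For q > p the variation of exponent q is at most
    L^q h^(qH - 1), which tends to 0.  For q <= p, once all increments are at most 1
    the variation of exponent q dominates that of exponent p, which stays away from
    0 (variation_index_holder). *)

Set Implicit Arguments.
Unset Strict Implicit.
Unset Printing Implicit Defensive.

Import Order.TTheory GRing.Theory Num.Theory.
Import numFieldNormedType.Exports.

Local Open Scope classical_set_scope.
Local Open Scope ring_scope.

(** * Elementary inequalities *)

Lemma powRD_gt0 {R : realType} (x a b : R) : 0 < x ->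
  x `^ (a + b) = x `^ a * x `^ b.
Proof. by move=> x0; rewrite powRD ?(gt_eqF x0)// implybT. Qed.

Section elementary.
Context {R : realType}.
Implicit Types (x y p u v : R).

(** For 2 x^2 <= 1 both exponentials are bounded through 1 + y <= exp y, which
    gives cosh x <= 1 / (1 - x^2); for larger x, |x| <= 2 x^2 suffices. *)
Lemma cosh_le_expR x : (expR x + expR (- x)) / 2 <= expR (2 * x ^+ 2).
Proof.
wlog x0 : x / 0 <= x.
  move=> W; have [/W//|x0] := leP 0 x.
  rewrite addrC -[X in (_ + expR X) / 2](opprK x).
  by rewrite -[X in _ <= expR (2 * X)]sqrrN; apply: W; rewrite oppr_ge0 ltW.
have [x2|x2] := leP (2 * x ^+ 2) 1; last first.
  have h : x <= 2 * x ^+ 2 by nra.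
  have h' : - x <= 2 * x ^+ 2 by nra.
  have e1 : expR x <= expR (2 * x ^+ 2) by rewrite ler_expR.
  have e2 : expR (- x) <= expR (2 * x ^+ 2) by rewrite ler_expR.
  by rewrite ler_pdivrMr// mulr_natr mulr2n lerD.
have x1 : x < 1 by nra.
have e1 : expR x <= (1 - x)^-1.
  rewrite -[x in expR x]opprK expRN lef_pV2 ?posrE ?expR_gt0 ?subr_gt0//.
  exact: expR_ge1Dx.
have e2 : expR (- x) <= (1 + x)^-1.
  have x1' : 0 < 1 + x by lra.
  by rewrite expRN lef_pV2 ?posrE ?expR_gt0// expR_ge1Dx.
have e3 : ((1 - x)^-1 + (1 + x)^-1) / 2 <= 1 + 2 * x ^+ 2.
  have -> : ((1 - x)^-1 + (1 + x)^-1) / 2 = (1 - x ^+ 2)^-1.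
    by field; apply/and3P; split; rewrite lt0r_neq0//; nra.
  rewrite -[X in X <= _]mul1r ler_pdivrMr; nra.
by have := expR_ge1Dx (2 * x ^+ 2); lra.
Qed.

(** This is Young's inequality for the product y * x^(p-1), rearranged. *)
Lemma powRB_le p x y : 1 < p -> 0 <= y -> y <= x ->
  x `^ p - y `^ p <= p * x `^ (p - 1) * (x - y).
Proof.
move=> p1 y0 yx; have x0 : 0 <= x by lra.
have p0 : 0 < p by lra.
have p10 : 0 < p - 1 by lra.
have := @conjugate_powR _ y (x `^ (p - 1)) p (p / (p - 1)) y0 (powR_ge0 _ _) p0 
  (divr_gt0 p0 p10).
have -> : p^-1 + (p / (p - 1))^-1 = 1 by field; rewrite !lt0r_neq0.
move=> /(_ erefl).
rewrite -powRrM.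
have -> : (p - 1) * (p / (p - 1)) = p by field; rewrite lt0r_neq0.
rewrite -(mulr_powRB1 x0 p0).
set a := x `^ (p - 1); set b := y `^ p.
have -> : b / p + x * a / (p / (p - 1)) = (b + x * a * (p - 1)) / p.
  by field; rewrite !lt0r_neq0.
rewrite ler_pdivlMr//; lra.
Qed.

Lemma normr_powRB_le p M x y : 1 < p -> `|x| <= M -> `|y| <= M ->
  `| `|x| `^ p - `|y| `^ p | <= p * M `^ (p - 1) * `|x - y|.
Proof.
move=> p1; wlog yx : x y / `|y| <= `|x|.
  by move=> W xM yM; have [/W|/ltW/W] := leP `|y| `|x|;
    [exact|rewrite distrC (distrC x); exact].
move=> xM yM; rewrite ger0_norm; last first.
  by rewrite subr_ge0 ge0_ler_powR ?nnegrE//; lra.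
apply: (le_trans (powRB_le p1 (normr_ge0 _) yx)).
apply: ler_pM.
- by rewrite mulr_ge0 ?powR_ge0//; lra.
- by rewrite subr_ge0.
- rewrite ler_wpM2l ?ge0_ler_powR ?nnegrE//; try lra.
  exact: le_trans xM.
- exact: lerB_dist.
Qed.

(** One of y + a and y - a is at least as large as a in absolute value.  This is
    what a single random sign contributes to the mean of a p-th power. *)
Lemma half_powR_le_symm p a y : 0 <= p ->
  `|a| `^ p / 2 <= (`|y + a| `^ p + `|y - a| `^ p) / 2.
Proof.
move=> p0; rewrite ler_pM2r ?invr_gt0//.
have [h|h] := leP `|a| `|y + a|.
  by apply: ler_wpDr; rewrite ?powR_ge0 ?ge0_ler_powR ?nnegrE.
apply: ler_wpDl; rewrite ?powR_ge0 ?ge0_ler_powR ?nnegrE//.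
have := ler_normD (y + a) (- (y - a)); rewrite normrN.
have -> : y + a + - (y - a) = 2 * a by ring.
rewrite normrM ger0_norm//; lra.
Qed.

End elementary.

(** * The tent function *)

Section tent.
Context {R : realType}.
Implicit Types (u v : R).

Definition clamp (M u : R) : R := Num.max 0 (Num.min u M).

Variant clamp_spec (M u : R) : R -> Prop :=
  | ClampLow of u <= 0 : clamp_spec M u 0
  | ClampMid of 0 <= u & u <= M : clamp_spec M u u
  | ClampHigh of M <= u : clamp_spec M u M.

Lemma clampP (M u : R) : 0 <= M -> clamp_spec M u (clamp M u).
Proof.
move=> M0; rewrite /clamp; have [uM|Mu] := leP u M; have [u0|u0] := leP 0 u.
- by constructor.
- by constructor; exact: ltW.
- by rewrite max_r//; constructor; exact: ltW.
- by rewrite max_r//; constructor; exact: ltW.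
Qed.

Variant tent_spec u : R -> Prop :=
  | TentLeft of u <= 0 : tent_spec u 0
  | TentUp of 0 <= u & u <= 2^-1 : tent_spec u u
  | TentDown of 2^-1 <= u & u <= 1 : tent_spec u (1 - u)
  | TentRight of 1 <= u : tent_spec u 0.

Lemma tentP u : tent_spec u (faber_schauder00 u).
Proof.
rewrite /faber_schauder00; have [uM|Mu] := leP u (1 - u).
  have [u0|u0] := leP 0 u; last by constructor; exact: ltW.
  by constructor; lra.
have [u1|u1] := leP 0 (1 - u); last by constructor; lra.
by constructor; lra.
Qed.

Lemma tent_ge0 u : 0 <= faber_schauder00 u.
Proof. by rewrite /faber_schauder00 le_max lexx. Qed.

Lemma tent_left u : u <= 0 -> faber_schauder00 u = 0.
Proof. by case: (tentP u) => *; lra. Qed.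

Lemma tent_up u : 0 <= u <= 2^-1 -> faber_schauder00 u = u.
Proof. by case: (tentP u) => *; lra. Qed.

Lemma tent_down u : 2^-1 <= u <= 1 -> faber_schauder00 u = 1 - u.
Proof. by case: (tentP u) => *; lra. Qed.

Lemma tent_right u : 1 <= u -> faber_schauder00 u = 0.
Proof. by case: (tentP u) => *; lra. Qed.

Lemma clampB_le (M : R) u v : 0 <= M -> u <= v ->
  0 <= clamp M v - clamp M u <= v - u.
Proof.
by move=> M0 uv; case: (clampP u M0) => *; case: (clampP v M0) => *; lra.
Qed.

(** With clampB_tent this exhibits the tent as a difference of two monotone
    functions dominated by a clamp, hence tent_incr. *)
Lemma clampD_tent u : clamp 1 u + faber_schauder00 u = clamp 1 (2 * u).
Proof.
by case: (tentP u) => *; case: (clampP u ler01) => *;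
  case: (clampP (2 * u) ler01) => *; lra.
Qed.

Lemma clampB_tent u : clamp 1 u - faber_schauder00 u = clamp 1 (2 * u - 1).
Proof.
by case: (tentP u) => *; case: (clampP u ler01) => *;
  case: (clampP (2 * u - 1) ler01) => *; lra.
Qed.

(** The increments of the clamp telescope, both over consecutive points and over
    integer translates, so this single bound controls the total variation of a tent
    and the sum over the translated tents of one level. *)
Lemma tent_incr u v : u <= v ->
  `|faber_schauder00 v - faber_schauder00 u| <= clamp 1 v - clamp 1 u.
Proof.
move=> uv; rewrite ler_norml.
have uv2 : 2 * u <= 2 * v by lra.
have uv3 : 2 * u - 1 <= 2 * v - 1 by lra.
have := clampB_le ler01 uv2; have := clampB_le ler01 uv3.
by rewrite -!clampD_tent -!clampB_tent => h1 h2; lra.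
Qed.

Lemma tent_le_clampB u : faber_schauder00 u <= clamp 1 u - clamp 1 (u - 1).
Proof.
by case: (tentP u) => *; case: (clampP u ler01) => *;
  case: (clampP (u - 1) ler01) => *; lra.
Qed.

Lemma clampS (M : nat) u : clamp M.+1%:R u = clamp M%:R u + clamp 1 (u - M%:R).
Proof.
rewrite -natr1; have M0 := ler0n R M; have M1 : 0 <= M%:R + 1 :> R by lra.
by case: (clampP u M0) => *; case: (clampP u M1) => *;
  case: (clampP (u - M%:R) ler01) => *; lra.
Qed.

Lemma sum_clamp (M : nat) u : \sum_(k < M) clamp 1 (u - k%:R) = clamp M%:R u.
Proof.
elim: M => [|M IH]; last by rewrite big_ord_recr /= IH clampS.
by rewrite big_ord0; case: (clampP u (lexx 0)) => *; lra.
Qed.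

Lemma clamp_itv (M : R) u : 0 <= M -> 0 <= clamp M u <= M.
Proof. by move=> M0; case: (clampP u M0) => *; lra. Qed.

(** The tent lies below the increment of the clamp over [u - 1, u], and these
    increments telescope over integer translates. *)
Lemma sum_tent_le1 (M : nat) u : \sum_(k < M) faber_schauder00 (u - k%:R) <= 1.
Proof.
have h : \sum_(k < M) faber_schauder00 (u - k%:R) <=
    clamp 1 u - clamp 1 (u - M%:R).
  elim: M => [|M IH]; first by rewrite big_ord0 subr0 subrr.
  rewrite big_ord_recr /=; have := tent_le_clampB (u - M%:R).
  rewrite -natr1 opprD addrA; lra.
by have := clamp_itv u ler01; have := clamp_itv (u - M%:R) ler01; lra.
Qed.

(** The bound by v - u comes from tent_incr, since the translated clamps add up to
    a longer clamp, which is 1-Lipschitz; the bound by 2 comes from the values of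
    the tents at the two endpoints. *)
Lemma sum_tentB_le (M : nat) u v : u <= v ->
  \sum_(k < M) `|faber_schauder00 (v - k%:R) - faber_schauder00 (u - k%:R)|
    <= 2 * Num.min 1 (v - u).
Proof.
move=> uv.
have h1 : \sum_(k < M) `|faber_schauder00 (v - k%:R) - faber_schauder00 (u - k%:R)|
    <= v - u.
  have /andP[_ h] := clampB_le (ler0n R M) uv.
  apply: le_trans h; rewrite -!sum_clamp -sumrB; apply: ler_sum => k _.
  by apply: tent_incr; lra.
have h2 : \sum_(k < M) `|faber_schauder00 (v - k%:R) - faber_schauder00 (u - k%:R)|
    <= 2.
  have := sum_tent_le1 M u; have := sum_tent_le1 M v.
  set a := \sum_(k < M) _; set b := \sum_(k < M) _ => a1 b1.
  apply: (@le_trans _ _ (a + b)); last lra.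
  rewrite /a /b -big_split /=; apply: ler_sum => k _.
  by rewrite (le_trans (ler_normB _ _))// !ger0_norm ?tent_ge0.
by rewrite minEle; case: ifP => _; lra.
Qed.

Lemma sum_tent_path_le1 (n : nat) (x : nat -> R) :
  (forall i, (i < n)%N -> x i <= x i.+1) ->
  \sum_(0 <= i < n) `|faber_schauder00 (x i.+1) - faber_schauder00 (x i)| <= 1.
Proof.
move=> xi; apply: (@le_trans _ _ (clamp 1 (x n) - clamp 1 (x 0%N))).
  rewrite -(telescope_sumr (fun i => clamp 1 (x i)))//.
  rewrite big_nat [leRHS]big_nat; apply: ler_sum => i /andP[_ iN].
  exact/tent_incr/xi.
by have := clamp_itv (x n) ler01; have := clamp_itv (x 0%N) ler01; lra.
Qed.

End tent.

(** * Geometric sums over the levels *)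

Section level_sums.
Context {R : realType}.

Lemma geometric_sum_le (q : R) N : 0 <= q -> q < 1 ->
  \sum_(m < N) q ^+ m <= (1 - q)^-1.
Proof.
move=> q0 q1; have q10 : 0 < 1 - q by lra.
rewrite -[leRHS]mul1r ler_pdivlMr// mulrC -opprB mulNr -subrX1 opprB.
by rewrite lerBlDr lerDl exprn_ge0.
Qed.

Lemma powR2_gt1 (x : R) : 0 < x -> 1 < 2 `^ x.
Proof.
move=> x0; rewrite /powR pnatr_eq0 /= expR_gt1 mulr_gt0// ln_gt0//; lra.
Qed.

Lemma powR_ge1 (d x : R) : 1 <= d -> 0 <= x -> 1 <= d `^ x.
Proof. by move=> d1 x0; rewrite -[leLHS](powRr0 d); exact: ler_powR. Qed.

Lemma powR2_lt1 (x : R) : x < 0 -> 2 `^ x < 1.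
Proof.
move=> x0; rewrite -[x]opprK powRN invf_lt1 ?powR_gt0// powR2_gt1//; lra.
Qed.

(** With q = 2^(-2H) the m-th term is at most min(q^m, (2q)^m d).  If 2q < 1, that is
    H > 1/2, the sum is of order d.  If 2q > 1 the terms grow like (2q)^m d until
    2^m d is about 1 and then decay like q^m, and the sum is of order d^(2H).
    In the second case the splitting is replaced by an induction on N, through
    the recursion G_(N+1)(d) = min(1, d) + q G_N(2d) satisfied by the sums. *)
Lemma level_sum_le (H : R) : 0 < H < 1 -> H != 2^-1 ->
  exists2 C : R, 0 < C & forall N (d : R), 0 <= d <= 1 ->
    \sum_(m < N) (2 `^ (- H)) ^+ (2 * m) * Num.min 1 (2 ^+ m * d)
      <= C * d `^ (Num.min 1 (2 * H)).
Proof.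
move=> /andP[H0 H1] Hh.
set q := (2 `^ (- H)) ^+ 2 : R.
have qE : q = 2 `^ (- (2 * H)).
  by rewrite /q -powR_mulrn ?powR_ge0// -powRrM; congr (_ `^ _); ring.
have q0 : 0 < q by rewrite qE powR_gt0.
have q1 : q < 1.
  by rewrite qE powR2_lt1//; lra.
have q2E : q * 2 = 2 `^ (- (2 * H) + 1).
  by rewrite powRD ?pnatr_eq0 ?implybT// powRr1// -qE.
pose G N d : R := \sum_(m < N) q ^+ m * Num.min 1 (2 ^+ m * d).
have GE N d : \sum_(m < N) (2 `^ (- H)) ^+ (2 * m) * Num.min 1 (2 ^+ m * d) = G N d.
  by apply: eq_bigr => m _; rewrite exprM.
clearbody q.
have GC N d : G N d <= (1 - q)^-1.
  apply: le_trans (geometric_sum_le N (ltW q0) q1).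
  apply: ler_sum => m _; rewrite -[leRHS]mulr1 ler_wpM2l//.
    by rewrite exprn_ge0// ltW.
  by rewrite ge_min lexx.
have [Hgt|Hle] := ltP 2^-1 H.
  have q21 : q * 2 < 1 by rewrite q2E powR2_lt1//; lra.
  exists (1 - q * 2)^-1; first by rewrite invr_gt0; lra.
  move=> N d /andP[d0 d1]; rewrite min_l; last lra.
  rewrite powRr1// GE.
  apply: (@le_trans _ _ ((\sum_(m < N) (q * 2) ^+ m) * d)).
    rewrite mulr_suml; apply: ler_sum => m _.
    rewrite exprMn -mulrA ler_wpM2l//.
      by rewrite exprn_ge0// ltW.
    by rewrite ge_min lexx orbT.
  by rewrite ler_wpM2r// geometric_sum_le//; lra.
have Hlt : H < 2^-1 by rewrite lt_neqAle Hh.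
have q21 : 1 < q * 2 by rewrite q2E powR2_gt1//; lra.
set K' := (q * 2 - 1)^-1; set K := (1 - q)^-1 + 2 * K'.
have K'0 : 0 < K' by rewrite invr_gt0; lra.
have Kq0 : 0 < (1 - q)^-1 by rewrite invr_gt0; lra.
have K'E : K' * (q * 2) = 1 + K'.
  by rewrite /K'; field; rewrite lt0r_neq0//; lra.
exists K; first by rewrite /K; lra.
move=> N d d01; rewrite min_r; last lra.
rewrite GE.
(* q (2d)^(2H) = d^(2H), so a bound K d^(2H) alone would leave no room for the
   term min(1, d); the correction - K' d, with K' (2q - 1) = 1, absorbs it. *)
suff W : forall d, 0 <= d <= 2 -> G N d <= K * d `^ (2 * H) - K' * d.
  have := W d _; case/andP: d01 => d0 d1.
  have : 0 <= K' * d by rewrite mulr_ge0// ltW.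
  move=> h W1; have := W1 ltac:(lra); lra.
move=> {d01}d; elim: N d => [|N IH] d /andP[d0 d2].
  rewrite /G big_ord0 subr_ge0.
  have [->|dn0] := eqVneq d 0; first by rewrite mulr0 mulr_ge0 ?powR_ge0// /K; lra.
  have {d0 dn0}d0 : 0 < d by rewrite lt_def dn0.
  have [d1|d1] := leP d 1.
    apply: ler_pM => //; [exact: ltW|exact: ltW|rewrite /K; lra|].
    by apply: ger1_powR; [rewrite d0|lra].
  apply: (@le_trans _ _ K); first by rewrite /K; nra.
  rewrite ler_peMr//; first by rewrite /K; lra.
  by apply: powR_ge1; lra.
have [d1|d1] := leP d 1; last first.
  apply: le_trans (GC _ _) _.
  have h : 1 <= d `^ (2 * H) by apply: powR_ge1; lra.
  have : K <= K * d `^ (2 * H) by rewrite ler_peMr// /K; lra.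
  rewrite {1}/K; have : K' * d <= K' * 2 by rewrite ler_pM2l.
  lra.
rewrite /G big_ord_recl expr0 mul1r expr0 mul1r.
rewrite (_ : \sum_(i < N) _ = q * G N (2 * d)); last first.
  rewrite /G mulr_sumr; apply: eq_bigr => i _.
  by rewrite lift0 !exprS; rewrite mulrA; congr (_ * Num.min _ _); ring.
have := IH (2 * d) ltac:(lra).
rewrite -(ler_pM2l q0) => h.
have E1 : q * (2 * d) `^ (2 * H) = d `^ (2 * H).
  by rewrite powRM// mulrA qE powRN mulVf ?mul1r// powR_eq0 pnatr_eq0.
rewrite mulrBr [q * (K * _)]mulrCA E1 in h.
have E2 : q * (K' * (2 * d)) = d + K' * d.
  by transitivity (K' * (q * 2) * d); [ring|rewrite K'E; ring].
rewrite E2 in h.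
have : Num.min 1 d <= d by rewrite ge_min lexx orbT.
lra.
Qed.

End level_sums.

(** * Averages over signs and bounded differences *)

Section sign_mean.
Context {R : realType} {I : eqType}.
Implicit Types (f g : I -> R) (F G : (I -> R) -> R) (J : seq I) (j : I).

Definition signs f : Prop := forall i, f i = 1 \/ f i = -1.

Definition upd f j (a : R) : I -> R := fun i => if i == j then a else f i.

(** The average of F over all assignments of signs to the entries of J; the
    coordinates outside J are those of f. *)
Fixpoint sign_mean J F f : R :=
  if J is j :: J' then
    (sign_mean J' F (upd f j 1) + sign_mean J' F (upd f j (-1))) / 2
  else F f.

Lemma signs_upd1 f j : signs f -> signs (upd f j 1).
Proof. by move=> sf i; rewrite /upd; case: eqP => _; [left|exact: sf]. Qed.

Lemma signs_updN1 f j : signs f -> signs (upd f j (-1)).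
Proof. by move=> sf i; rewrite /upd; case: eqP => _; [right|exact: sf]. Qed.

Lemma sign_mean_le J F G f : signs f -> (forall g, signs g -> F g <= G g) ->
  sign_mean J F f <= sign_mean J G f.
Proof.
move=> + FG; elim: J f => [|j J IH] f sf /=; first exact: FG.
have := IH _ (signs_upd1 j sf); have := IH _ (signs_updN1 j sf); lra.
Qed.

Lemma sign_mean_cst J (c : R) f : sign_mean J (fun=> c) f = c.
Proof. by elim: J f => [|j J IH] f //=; rewrite !IH; lra. Qed.

Lemma sign_meanD J F G f :
  sign_mean J (fun g => F g + G g) f = sign_mean J F f + sign_mean J G f.
Proof. by elim: J f => [|j J IH] f //=; rewrite !IH; lra. Qed.

Lemma sign_meanM J (c : R) F f :
  sign_mean J (fun g => c * F g) f = c * sign_mean J F f.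
Proof. by elim: J f => [|j J IH] f //=; rewrite !IH; lra. Qed.

Lemma sign_mean_sum (A : Type) (s : seq A) J (F : A -> (I -> R) -> R) f :
  sign_mean J (fun g => \sum_(a <- s) F a g) f =
  \sum_(a <- s) sign_mean J (F a) f.
Proof.
elim: s => [|a s IH].
  rewrite big_nil -[RHS](sign_mean_cst J 0 f); congr (sign_mean _ _ _).
  by apply/funext => g; rewrite big_nil.
rewrite big_cons -IH -sign_meanD; congr (sign_mean _ _ _).
by apply/funext => g; rewrite big_cons.
Qed.

Lemma updC f j j' a b : j != j' -> upd (upd f j a) j' b = upd (upd f j' b) j a.
Proof.
move=> jj'; apply/funext => i; rewrite /upd.
by have [->|//] := eqVneq i j'; rewrite eq_sym (negbTE jj').
Qed.

Lemma sign_mean_upd J F f j a : j \notin J ->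
  sign_mean J F (upd f j a) = sign_mean J (fun g => F (upd g j a)) f.
Proof.
elim: J f => [//|i J IH] f; rewrite inE negb_or => /andP[ji jJ] /=.
by rewrite !(updC _ _ _ ji) !IH.
Qed.

(** An average over the signs of J may first average over one chosen sign. *)
Lemma sign_mean_symm J F f j : j \in J ->
  sign_mean J F f =
  sign_mean J (fun g => (F (upd g j 1) + F (upd g j (-1))) / 2) f.
Proof.
elim: J f => [//|i J IH] f; have [jJ _|jJ] := boolP (j \in J).
  by rewrite /= !(IH _ jJ).
rewrite inE (negbTE jJ) orbF => /eqP <- /=.
have updK g a b : upd (upd g j a) j b = upd g j b.
  by apply/funext => k; rewrite /upd; case: eqP.
have E a : sign_mean J (fun g => (F (upd g j 1) + F (upd g j (-1))) / 2) (upd f j a)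
   = (sign_mean J F (upd f j 1) + sign_mean J F (upd f j (-1))) / 2.
  rewrite sign_mean_upd//; under [X in sign_mean _ X]eq_fun do rewrite !updK mulrC.
  by rewrite sign_meanM sign_meanD mulrC !(sign_mean_upd F f _ jJ).
by rewrite !E; lra.
Qed.

Lemma sign_mean_ge J F f j (b : R) : signs f -> j \in J ->
  (forall g, signs g -> b <= (F (upd g j 1) + F (upd g j (-1))) / 2) ->
  b <= sign_mean J F f.
Proof.
move=> sf jJ h; rewrite (sign_mean_symm F f jJ) -[leLHS](sign_mean_cst J b f).
exact: sign_mean_le.
Qed.

Definition agree_off j f g : Prop := forall i, i != j -> f i = g i.

Definition bounded_difference F j (D : R) : Prop :=
  forall f g, signs f -> signs g -> agree_off j f g -> `|F f - F g| <= D.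

Lemma bounded_difference_mean J F j D :
  bounded_difference F j D -> bounded_difference (sign_mean J F) j D.
Proof.
move=> bF; elim: J => [//|i J IH] f g sf sg fg /=.
have ag a : agree_off j (upd f i a) (upd g i a).
  by move=> k kj; rewrite /upd; case: eqP => // _; exact: fg.
have := IH _ _ (signs_upd1 i sf) (signs_upd1 i sg) (ag _).
have := IH _ _ (signs_updN1 i sf) (signs_updN1 i sg) (ag _).
rewrite !ler_norml => h1 h2; lra.
Qed.

(** The bounded difference inequality in exponential form, by induction on J.
    Averaging over one more sign replaces exp (l A) and exp (l B) by their mean, which
    is exp (l (A + B) / 2) cosh (l (A - B) / 2), and |A - B| <= D j. *)
Lemma sign_mean_expR_le J F f (D : I -> R) (l : R) : signs f ->
  (forall j, j \in J -> bounded_difference F j (D j)) ->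
  sign_mean J (fun g => expR (l * F g)) f <=
  expR (l * sign_mean J F f + l ^+ 2 / 2 * \sum_(j <- J) D j ^+ 2).
Proof.
elim: J f => [|j J IH] f sf bF /=; first by rewrite big_nil mulr0 addr0.
have sp := signs_upd1 j sf; have sm := signs_updN1 j sf.
have bFJ i : i \in J -> bounded_difference F i (D i).
  by move=> iJ; apply: bF; rewrite inE iJ orbT.
have := IH _ sp bFJ; have := IH _ sm bFJ.
have : `|sign_mean J F (upd f j 1) - sign_mean J F (upd f j (-1))| <= D j.
  apply: (bounded_difference_mean J (bF j (mem_head _ _)) sp sm).
  by move=> i ij; rewrite /upd (negbTE ij).
set A := sign_mean J F _; set B := sign_mean J F _.
set A' := sign_mean J _ _; set B' := sign_mean J _ _.
rewrite big_cons; set S := \sum_(i <- J) _.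
move=> AB hB hA.
set E := l ^+ 2 / 2 * S; set y := l * (A - B) / 2.
have eA : expR (l * A + E) = expR (l * ((A + B) / 2) + E) * expR y.
  by rewrite -expRD; congr expR; rewrite /y; field.
have eB : expR (l * B + E) = expR (l * ((A + B) / 2) + E) * expR (- y).
  by rewrite -expRD; congr expR; rewrite /y; field.
apply: (@le_trans _ _ (expR (l * ((A + B) / 2) + E) * expR (2 * y ^+ 2))).
  apply: (@le_trans _ _ (expR (l * ((A + B) / 2) + E) *
      ((expR y + expR (- y)) / 2))).
    by rewrite mulrA mulrDr -eA -eB ler_pM2r ?invr_gt0// lerD.
  by rewrite ler_pM2l ?expR_gt0// cosh_le_expR.
rewrite -expRD ler_expR mulrDr -addrA lerD2l addrC lerD2r.
have -> : 2 * y ^+ 2 = l ^+ 2 / 2 * (A - B) ^+ 2 by rewrite /y; field.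
rewrite ler_wpM2l ?divr_ge0 ?sqr_ge0// -[(A - B) ^+ 2]real_normK ?num_real//.
by rewrite lerXn2r ?nnegrE// (le_trans _ AB).
Qed.

End sign_mean.

(** * Integrals of functions that are not known to be measurable *)

(** The power variation of the infinite series is known to be a limit of measurable
    functions only where all the coefficients are signs, that is, almost everywhere.
    Comparison with a measurable function still determines its integral, because the
    integral of a nonnegative function is a supremum over simple functions below
    it. *)
Section integrals.
Context {d : measure_display} {T : measurableType d} {R : realType}
  (mu : {measure set T -> \bar R}).
Local Open Scope ereal_scope.

Lemma ge0_le_integral_pointwise (f g : T -> \bar R) :
  (forall x, 0 <= f x) -> (forall x, f x <= g x) ->
  \int[mu]_x f x <= \int[mu]_x g x.
Proof.
move=> f0 fg; have g0 x : 0 <= g x by exact: le_trans (fg x).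
rewrite !ge0_integralTE//; apply: ereal_sup_le => _ [h /= hf <-].
by exists h => // x; exact: le_trans (fg x).
Qed.

Lemma ae_le_integral_measr (f g : T -> \bar R) :
  (forall x, 0 <= f x) -> (forall x, 0 <= g x) -> measurable_fun setT g ->
  {ae mu, forall x, f x <= g x} ->
  \int[mu]_x f x <= \int[mu]_x g x.
Proof.
move=> f0 g0 mg [N [mN N0 fgN]].
pose h x := if x \in N then +oo else g x.
have mh : measurable_fun setT h.
  apply: measurable_fun_ifT => //.
  by apply: measurable_fun_bool; rewrite setTI; rewrite (_ : _ @^-1` _ = N)//;
   apply/seteqP; split => x; [exact: set_mem|exact: mem_set].
have h0 x : 0 <= h x by rewrite /h; case: ifP.
apply: (@le_trans _ _ (\int[mu]_x h x)).
  apply: ge0_le_integral_pointwise => // x; rewrite /h.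
  case: (boolP (x \in N)) => [_|]; first exact: leey.
  by rewrite notin_setE => xN; apply: contrapT => /fgN.
rewrite (ge0_ae_eq_integral (g := g))//.
exists N; split => // x /= xg; apply: contrapT => xN; apply: xg => _.
by rewrite /h memNset.
Qed.

Lemma ae_le_integral_measl (f g : T -> \bar R) :
  (forall x, 0 <= f x) -> (forall x, 0 <= g x) -> measurable_fun setT f ->
  {ae mu, forall x, f x <= g x} ->
  \int[mu]_x f x <= \int[mu]_x g x.
Proof.
move=> f0 g0 mf [N [mN N0 fgN]].
pose h x := if x \in N then 0 else f x.
have mh : measurable_fun setT h.
  apply: measurable_fun_ifT => //.
  by apply: measurable_fun_bool; rewrite setTI; rewrite (_ : _ @^-1` _ = N)//;
   apply/seteqP; split => x; [exact: set_mem|exact: mem_set].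
have h0 x : 0 <= h x by rewrite /h; case: ifP.
apply: (@le_trans _ _ (\int[mu]_x h x)); last first.
  apply: ge0_le_integral_pointwise => // x; rewrite /h.
  case: (boolP (x \in N)) => [_//|].
  by rewrite notin_setE => xN; apply: contrapT => /fgN.
rewrite [leRHS](ge0_ae_eq_integral (g := f))//.
exists N; split => // x /= xg; apply: contrapT => xN; apply: xg => _.
by rewrite /h memNset.
Qed.

End integrals.

Lemma measurable_le_set {d : measure_display} {T : measurableType d}
    {R : realType} (f g : T -> R) : measurable_fun setT f ->
  measurable_fun setT g -> measurable [set w | f w <= g w].
Proof.
move=> mf mg; rewrite -[X in measurable X]setTI.
rewrite (_ : [set w | _] = (fun w => f w <= g w) @^-1` [set true])//.
exact: measurable_fun_ler.
Qed.

(** * Functions of finitely many independent signs *)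

Definition depends_on {R : realType} {I : eqType} (J : seq I)
    (F : (I -> R) -> R) : Prop :=
  forall f g, (forall i, i \in J -> f i = g i) -> F f = F g.

Section rademacher_family.
Context {d : measure_display} {T : measurableType d} {R : realType}
  (P : probability T R) {I : eqType} (theta : I -> {RV P >-> R}).
Hypothesis theta_rad : forall i, is_rademacher (theta i).
Hypothesis theta_indep : mutually_independent theta.

Let sample (w : T) : I -> R := fun i => theta i w.

Definition cylinder (K : seq I) (f : I -> R) : set T :=
  \bigcap_(i in [set` K]) theta i @^-1` [set f i].

Lemma measurable_fiber i (a : R) : measurable (theta i @^-1` [set a]).
Proof. exact: measurable_funPTI. Qed.

Lemma measurable_cylinder K f : measurable (cylinder K f).
Proof.
apply: fin_bigcap_measurable; first exact: finite_seq.
by move=> i _; exact: measurable_fiber.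
Qed.

Lemma probability_cylinder K f : uniq K -> signs f ->
  P (cylinder K f) = (2^-1 ^+ size K)%:E.
Proof.
move=> uK sf; rewrite /cylinder (theta_indep (B := fun i => [set f i]))//.
elim: K {uK} => [|i K IH]; first by rewrite big_nil.
rewrite big_cons IH exprS EFinM; congr (_ * _)%E.
by have [h1 h2] := theta_rad i; case: (sf i) => ->.
Qed.

Let nonsign i : set T := ~` (theta i @^-1` [set 1] `|` theta i @^-1` [set -1]).

Let fiber_disj i : theta i @^-1` [set 1] `&` theta i @^-1` [set -1] = set0.
Proof.
by apply/seteqP; split => // w [/= -> h]; exfalso; lra.
Qed.

Lemma nonsign_null i :
  P (~` (theta i @^-1` [set 1] `|` theta i @^-1` [set -1])) = 0%E.
Proof.
rewrite probability_setC; last by apply: measurableU; exact: measurable_fiber.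
rewrite measureU//; try exact: measurable_fiber.
have [h1 h2] := theta_rad i.
rewrite [X in (1 - X)%E](_ : _ = (2^-1)%:E + (2^-1)%:E)%E; last by congr (_ + _)%E.
rewrite -EFinD (_ : 2^-1 + 2^-1 = 1); last lra.
by rewrite subrr.
Qed.

Let measurable_nonsign i : measurable (nonsign i).
Proof. by apply: measurableC; apply: measurableU; exact: measurable_fiber. Qed.

Lemma cylinder_cons K f j a : j \notin K ->
  cylinder (j :: K) (upd f j a) = cylinder K f `&` theta j @^-1` [set a].
Proof.
move=> jK; apply/seteqP; split => w /=.
  move=> h; split; last first.
    by have := h j; rewrite /= /upd eqxx; apply; exact: mem_head.
  move=> i /= iK; have := h i; rewrite /= /upd; case: eqP => [ij|_].
    by move: jK; rewrite -ij iK.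
  by apply; rewrite inE iK orbT.
move=> [h hj] i /=; rewrite inE /upd; case: eqP => [-> _//|_ /= iK].
exact: h.
Qed.

(** A cylinder splits, up to a null set, according to the value of one more sign,
    and each half has half the probability: this matches the recursion defining
    sign_mean.  On a cylinder fixing all the signs on which F depends, F is
    constant. *)
Lemma integral_cylinder (J K : seq I) (F : (I -> R) -> R) (f : I -> R) :
  uniq (K ++ J) -> signs f ->
  (forall g, 0 <= F g) -> measurable_fun setT (F \o sample) ->
  depends_on (K ++ J) F ->
  (\int[P]_(w in cylinder K f) (F (sample w))%:E)%E =
  (2^-1 ^+ size K * sign_mean J F f)%:E.
Proof.
move=> + + F0 mF; elim: J K f => [|j J IH] K f uKJ sf dF.
  rewrite cats0 in uKJ dF *.
  rewrite (eq_integral (fun=> (F f)%:E)); last first.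
    move=> w /set_mem h; congr EFin; apply: dF => i iK; exact: h.
  rewrite (integral_cst P (measurable_cylinder K f) (F f)%:E).
  rewrite mulrC EFinM; congr (_ * _)%E.
  exact: probability_cylinder.
have pe : perm_eq (K ++ j :: J) ((j :: K) ++ J) by rewrite (perm_catCA K [:: j] J).
have uK' : uniq ((j :: K) ++ J).
  by rewrite -(perm_uniq pe).
have dF' : depends_on ((j :: K) ++ J) F.
  by move=> g g' h; apply: dF => i; rewrite (perm_mem pe); exact: h.
have jK : j \notin K by move: uK'; rewrite /= mem_cat negb_or => /andP[/andP[]].
have /measurable_EFinP mE := mF.
rewrite (ge0_negligible_integral (measurable_nonsign j))//; last 4 first.
- exact: measurable_cylinder.
- exact: measurable_funTS.
- by move=> w _; rewrite lee_fin.
- exact: nonsign_null.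
have -> : cylinder K f `\` nonsign j =
    cylinder (j :: K) (upd f j 1) `|` cylinder (j :: K) (upd f j (-1)).
  by rewrite !cylinder_cons// -setIUr /nonsign setDE setCK.
rewrite ge0_integral_setU//; first last.
- rewrite !cylinder_cons//; apply/disj_setPS => w [[_ h1] [_ h2]].
  by rewrite -(fiber_disj j); split.
- by move=> w _; rewrite lee_fin.
- exact: measurable_funTS.
- exact: measurable_cylinder.
- exact: measurable_cylinder.
rewrite (IH (j :: K) (upd f j 1))//; last exact: signs_upd1.
rewrite (IH (j :: K) (upd f j (-1)))//; last exact: signs_updN1.
by rewrite -EFinD /= exprS; congr EFin; field.
Qed.

Lemma expectation_sign_mean (J : seq I) (F : (I -> R) -> R) (f : I -> R) :
  uniq J -> signs f ->
  (forall g, 0 <= F g) -> measurable_fun setT (F \o sample) ->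
  depends_on J F ->
  ('E_P[F \o sample] = (sign_mean J F f)%:E)%E.
Proof.
move=> uJ sf F0 mF dF; have := @integral_cylinder J [::] F f uJ sf F0 mF dF.
rewrite /= expr0 mul1r => <-; rewrite unlock; congr integral.
by rewrite /cylinder set_nil bigcap_set0.
Qed.

(** Chernoff's method with sign_mean_expR_le at the optimal parameter t / V. *)
Lemma upper_tail_le (J : seq I) (F : (I -> R) -> R) (f : I -> R)
    (D : I -> R) (V t : R) : uniq J -> signs f ->
  measurable_fun setT (F \o sample) -> depends_on J F ->
  (forall j, j \in J -> bounded_difference F j (D j)) ->
  0 < V -> \sum_(j <- J) D j ^+ 2 <= V -> 0 < t ->
  (P [set w | sign_mean J F f + t <= F (sample w)]%R <=
    (expR (- (t ^+ 2 / (2 * V))))%:E)%E.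
Proof.
move=> uJ sf mF dF bF V0 DV t0.
set m := sign_mean J F f; set A := [set w | _].
set l := t / V.
pose G g := expR (- (l * (m + t))) * expR (l * F g).
have mG : measurable_fun setT (G \o sample).
  apply: measurable_funM => //; apply: measurableT_comp => //.
  exact: measurable_funM.
have mA : measurable A by exact: measurable_le_set.
have G0 g : 0 <= G g by rewrite mulr_ge0 ?expR_ge0.
have EG : ('E_P[G \o sample] = (sign_mean J G f)%:E)%E.
  apply: expectation_sign_mean => // g g' gg'.
  by rewrite /G (dF g g').
have l0 : 0 < l by rewrite divr_gt0.
apply: (@le_trans _ _ 'E_P[G \o sample]%E).
  rewrite -(expectation_indic P mA); apply: expectation_le => //.
    by move=> w; exact: G0.
  apply: aeW => w /=; rewrite indicE; case: (boolP (w \in A)) => [/set_mem wA|_].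
    rewrite /G -expRD -[leLHS]expR0 ler_expR -lerBlDl sub0r opprK.
    by rewrite ler_pM2l.
  exact: G0.
rewrite EG lee_fin /G sign_meanM.
apply: (@le_trans _ _ (expR (- (l * (m + t))) *
   expR (l * m + l ^+ 2 / 2 * \sum_(j <- J) D j ^+ 2))).
  by rewrite ler_pM2l ?expR_gt0//; exact: sign_mean_expR_le.
rewrite -expRD ler_expR.
have : l ^+ 2 / 2 * (\sum_(j <- J) D j ^+ 2) <= l ^+ 2 / 2 * V.
  by rewrite ler_wpM2l// divr_ge0 ?sqr_ge0.
have -> : l ^+ 2 / 2 * V = t ^+ 2 / (2 * V).
  by rewrite /l; field; rewrite lt0r_neq0.
have E1 : l * t = 2 * (t ^+ 2 / (2 * V)) by rewrite /l; field; rewrite lt0r_neq0.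
by rewrite mulrDr E1; lra.
Qed.

Lemma two_sided_tail_le (J : seq I) (F : (I -> R) -> R) (f : I -> R)
    (D : I -> R) (V t : R) : uniq J -> signs f ->
  measurable_fun setT (F \o sample) -> depends_on J F ->
  (forall j, j \in J -> bounded_difference F j (D j)) ->
  0 < V -> \sum_(j <- J) D j ^+ 2 <= V -> 0 < t ->
  (P [set w | t <= `|F (sample w) - sign_mean J F f|]%R <=
    (2 * expR (- (t ^+ 2 / (2 * V))))%:E)%E.
Proof.
move=> uJ sf mF dF bF V0 DV t0.
pose F' g := (-1) * F g.
have mF' : measurable_fun setT (F' \o sample) by exact: measurable_funM.
have hle (G : (I -> R) -> R) : measurable_fun setT (G \o sample) ->
    measurable [set w | sign_mean J G f + t <= G (sample w)].
  by move=> mG; exact: measurable_le_set.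
have h1 := upper_tail_le uJ sf mF dF bF V0 DV t0.
have h2 : (P [set w | sign_mean J F' f + t <= F' (sample w)]%R <=
    (expR (- (t ^+ 2 / (2 * V))))%:E)%E.
  apply: (upper_tail_le (D := D)) => //.
    by move=> g g' gg'; rewrite /F' (dF g g').
  move=> j jJ g g' sg sg' gg'; rewrite /F' !mulN1r -opprD normrN.
  exact: bF.
rewrite mulr_natl mulr2n EFinD; apply: le_trans (leeD h1 h2).
apply: le_trans (measureU2 _ _ _); [|exact: hle|exact: hle].
apply: le_measure; rewrite ?inE.
- apply: measurable_le_set => //; apply: measurableT_comp => //.
  exact: measurable_funB.
- by apply: measurableU; exact: hle.
move=> w /=; rewrite ler_normr => /orP[h|h]; [left|right]; first lra.
rewrite (sign_meanM J (-1) F f) /F'; lra.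
Qed.

End rademacher_family.

Section expectation_of_approximations.
Context {d : measure_display} {T : measurableType d} {R : realType}
  (P : probability T R).

Lemma ae_signs {I : countType} (theta : I -> {RV P >-> R}) :
  (forall i, is_rademacher (theta i)) ->
  \forall w \ae P, signs (fun i => theta i w).
Proof.
move=> rad.
have h n : \forall w \ae P, forall i : I, pickle i = n ->
    theta i w = 1 \/ theta i w = -1.
  have [[i iE]|ni] := pselect (exists i : I, pickle i = n).
    exists (~` (theta i @^-1` [set 1] `|` theta i @^-1` [set -1])); split.
    - by apply: measurableC; apply: measurableU; exact: measurable_fiber.
    - exact: nonsign_null.
    move=> w /= hw; apply: contra_not hw => hs j jE.
    have -> // : j = i by apply: (pcan_inj pickleK); rewrite jE iE.
  by apply: aeW => w i iE; case: ni; exists i.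
by apply: filterS (ae_foralln h) => w hw i; exact: (hw (pickle i) i erefl).
Qed.

Context {I : eqType} (theta : I -> {RV P >-> R}).
Hypothesis theta_rad : forall i, is_rademacher (theta i).
Hypothesis theta_indep : mutually_independent theta.
Let sample (w : T) : I -> R := fun i => theta i w.

(** V itself need not be measurable: it is compared with the measurable functions
    F + eps and max(0, F - eps) of finitely many signs, the maximum keeping the lower
    one nonnegative. *)
Lemma expectation_near_sign_mean (J : seq I) (F : (I -> R) -> R) (f : I -> R)
    (V : T -> R) (eps : R) : uniq J -> signs f -> (forall g, 0 <= F g) ->
  measurable_fun setT (F \o sample) -> depends_on J F -> (forall w, 0 <= V w) ->
  0 <= eps ->
  (\forall w \ae P, `|V w - F (sample w)| <= eps) ->
  exists e, ('E_P[V] = e%:E)%E /\ `|e - sign_mean J F f| <= eps.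
Proof.
move=> uJ sf F0 mF dF V0 eps0 hV.
set m := sign_mean J F f.
have up : ('E_P[V] <= (m + eps)%:E)%E.
  pose F' g := F g + eps.
  have mF' : measurable_fun setT (F' \o sample).
    exact: measurable_funD.
  have <- : ('E_P[F' \o sample] = (m + eps)%:E)%E.
    rewrite (expectation_sign_mean theta_rad theta_indep (J := J) (f := f))//.
    - by rewrite /F' sign_meanD sign_mean_cst.
    - by move=> g; rewrite /F' addr_ge0.
    - by move=> g g' gg'; rewrite /F' (dF g g').
  rewrite unlock; apply: ae_le_integral_measr => //.
  - by move=> w; rewrite lee_fin /F' /= addr_ge0.
  - exact/measurable_EFinP.
  apply: filterS hV => w; rewrite lee_fin ler_norml /F' => /andP[_] /=; lra.
have lo : ((m - eps)%:E <= 'E_P[V])%E.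
  pose F' g := Num.max 0 (F g - eps).
  have F'0 g : 0 <= F' g by rewrite /F' le_max lexx.
  have mF' : measurable_fun setT (F' \o sample).
    by apply: measurable_maxr => //; exact: measurable_funB.
  apply: (@le_trans _ _ 'E_P[F' \o sample]%E).
    rewrite (expectation_sign_mean theta_rad theta_indep (J := J) (f := f))//.
      rewrite lee_fin /m -[eps](sign_mean_cst J _ f) -mulN1r -sign_meanM -sign_meanD.
      apply: sign_mean_le => // g _; rewrite /F' le_max mulN1r; apply/orP; right.
      by [].
    by move=> g g' gg'; rewrite /F' (dF g g').
  rewrite unlock; apply: ae_le_integral_measl => //.
  - by move=> w; rewrite lee_fin F'0.
  - exact/measurable_EFinP.
  apply: filterS hV => w; rewrite lee_fin ler_norml => /andP[h _] /=.
  by rewrite /F' ge_max V0 /=; lra.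
case: ('E_P[V]%E) up lo => [e| |] //; rewrite !lee_fin => up lo.
by exists e; split => //; rewrite ler_norml; lra.
Qed.

End expectation_of_approximations.

(** * Partitions *)

Section partition_facts.
Context {R : realType}.
Implicit Types (s : seq R) (i : nat).

Definition step s i : R := partition_pt s i.+1 - partition_pt s i.

Lemma partition_ptS s i : itv_partition 0 1 s -> (i < size s)%N ->
  partition_pt s i < partition_pt s i.+1.
Proof. by move=> [/(pathP 1) h _] /h. Qed.

Lemma step_gt0 s i : itv_partition 0 1 s -> (i < size s)%N -> 0 < step s i.
Proof. by move=> hs si; rewrite subr_gt0 partition_ptS. Qed.

Lemma partition_pt_last s : itv_partition 0 1 s -> partition_pt s (size s) = 1.
Proof.
move=> [_ /eqP sl]; rewrite -[RHS]sl /partition_pt.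
by rewrite -[RHS]/(last 0 (0 :: s)) -nth_last /=; exact: set_nth_default.
Qed.

Lemma partition_pt_le s i j : itv_partition 0 1 s -> (i <= j)%N ->
  (j <= size s)%N -> partition_pt s i <= partition_pt s j.
Proof.
move=> hs; elim: j => [|j IH]; first by rewrite leqn0 => /eqP ->.
rewrite leq_eqVlt => /orP[/eqP -> //|ij] js.
by apply: (le_trans (IH ij (ltnW js))); apply/ltW/partition_ptS.
Qed.

Lemma partition_pt_itv s i : itv_partition 0 1 s -> (i <= size s)%N ->
  0 <= partition_pt s i <= 1.
Proof.
move=> hs si; have := partition_pt_le hs si (leqnn _).
by rewrite partition_pt_last// => ->; rewrite andbT (@partition_pt_le s 0).
Qed.

Lemma sum_step s : itv_partition 0 1 s -> \sum_(0 <= i < size s) step s i = 1.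
Proof.
by move=> hs; rewrite telescope_sumr// partition_pt_last// /partition_pt subr0.
Qed.

Lemma step_le_mesh s i : (i < size s)%N -> step s i <= mesh s.
Proof.
move=> si; rewrite /mesh big_mkord.
exact: (@le_bigmax_cond _ R _ 0 (Ordinal si) xpredT
  (fun i : 'I_(size s) => step s i)).
Qed.

Lemma mesh_gt0 s : itv_partition 0 1 s -> 0 < mesh s.
Proof.
move=> hs; have s0 : (0 < size s)%N.
  by case: s hs => // -[_ /eqP /= /esym /eqP]; rewrite oner_eq0.
exact: lt_le_trans (step_gt0 hs s0) (step_le_mesh s0).
Qed.

End partition_facts.

(** * Faber-Schauder coefficients *)

Section hats.
Context {R : realType}.
Implicit Types (H t u : R).

Definition node := {n : nat & 'I_(2 ^ n)}.

Definition nodes (N : nat) : seq node :=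
  [seq Tagged (fun n => 'I_(2 ^ n)) k | m <- iota 0 N, k <- enum 'I_(2 ^ m)].

Lemma nodes_uniq N : uniq (nodes N).
Proof.
apply: allpairs_uniq_dep; first exact: iota_uniq.
  by move=> m _; exact: enum_uniq.
by move=> [m k] [m' k'] _ _ /=.
Qed.

Lemma mem_nodes N (j : node) : (j \in nodes N) = (tag j < N)%N.
Proof.
apply/allpairsPdep/idP => [[m [k [mN _ ->]]]|jN].
  by move: mN; rewrite mem_iota.
exists (tag j), (tagged j); split; rewrite ?mem_iota ?mem_enum//.
by case: j jN.
Qed.

Lemma sum_nodes N (G : node -> R) :
  \sum_(j <- nodes N) G j =
  \sum_(m < N) \sum_(k < 2 ^ m) G (Tagged (fun n => 'I_(2 ^ n)) k).
Proof.
rewrite big_allpairs_dep /= -[X in iota 0 X]subn0 -/(index_iota 0 N) big_mkord.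
by apply: eq_bigr => m _; rewrite big_enum.
Qed.

Definition hat H (j : node) t : R :=
  (2 `^ (- H)) ^+ tag j * faber_schauder00 (2 ^+ tag j * t - (tagged j)%:R).

Definition partial_tl H N (f : node -> R) t : R :=
  \sum_(j <- nodes N) f j * hat H j t.

Lemma ratio_gt0 H : 0 < 2 `^ (- H) :> R.
Proof. exact: powR_gt0. Qed.

Lemma ratioX_gt0 H m : 0 < (2 `^ (- H)) ^+ m :> R.
Proof. by rewrite exprn_gt0// ratio_gt0. Qed.

Lemma hat_ge0 H j t : 0 <= hat H j t.
Proof. by rewrite mulr_ge0 ?tent_ge0// exprn_ge0// powR_ge0. Qed.

(** The supports of the hats of one level have disjoint interiors. *)
Lemma sum_hat_le H m t :
  \sum_(k < 2 ^ m) hat H (Tagged (fun n => 'I_(2 ^ n)) k) t <= (2 `^ (- H)) ^+ m.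
Proof.
rewrite /hat /= -mulr_sumr -[leRHS]mulr1 ler_pM2l ?ratioX_gt0//.
exact: sum_tent_le1.
Qed.

Lemma sum_hatB_le H m u t : u <= t ->
  \sum_(k < 2 ^ m) `|hat H (Tagged (fun n => 'I_(2 ^ n)) k) t -
                     hat H (Tagged (fun n => 'I_(2 ^ n)) k) u|
    <= (2 `^ (- H)) ^+ m * (2 * Num.min 1 (2 ^+ m * (t - u))).
Proof.
move=> ut; rewrite /hat /=.
under eq_bigr do rewrite -mulrBr normrM (gtr0_norm (ratioX_gt0 _ _)).
rewrite -mulr_sumr ler_pM2l ?ratioX_gt0// mulrBr.
by apply: sum_tentB_le; rewrite ler_pM2l ?exprn_gt0.
Qed.

Lemma hat_path_le H j (n : nat) (x : nat -> R) :
  (forall i, (i < n)%N -> x i <= x i.+1) ->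
  \sum_(0 <= i < n) `|hat H j (x i.+1) - hat H j (x i)| <= (2 `^ (- H)) ^+ tag j.
Proof.
move=> xi; rewrite /hat.
under eq_bigr do rewrite -mulrBr normrM (gtr0_norm (ratioX_gt0 _ _)).
rewrite -mulr_sumr -[leRHS]mulr1 ler_pM2l ?ratioX_gt0//.
apply: (@sum_tent_path_le1 _ n (fun i => 2 ^+ tag j * x i - (tagged j)%:R)).
by move=> i /xi h; rewrite lerD2r ler_pM2l ?exprn_gt0.
Qed.

Lemma partial_tl_upd H N f (j : node) a t : (tag j < N)%N ->
  partial_tl H N (upd f j a) t = partial_tl H N (upd f j 0) t + a * hat H j t.
Proof.
rewrite -mem_nodes => jN; rewrite /partial_tl.
rewrite !(bigD1_seq j jN (nodes_uniq N)) /= {1 3}/upd eqxx mul0r add0r addrC.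
congr (_ + _); apply: eq_bigr => i ij; by rewrite /upd (negbTE ij).
Qed.

Lemma partial_tlB H N f g (j : node) t : (tag j < N)%N -> agree_off j f g ->
  partial_tl H N f t - partial_tl H N g t = (f j - g j) * hat H j t.
Proof.
move=> jN fg.
have fE : upd f j (f j) = f by apply/funext => i; rewrite /upd; case: eqP => // ->.
have gE : upd f j (g j) = g.
  by apply/funext => i; rewrite /upd; case: eqP => [->//|/eqP ij]; rewrite fg.
have := partial_tl_upd H f (f j) t jN; rewrite fE => ->.
have := partial_tl_upd H f (g j) t jN; rewrite gE => ->; ring.
Qed.

(** A step of length between 1/8 and 1/4 could only be invisible to the tents if it
    were placed symmetrically around a peak or a zero.  At a zero k one of the two
    tents meeting there changes by at least half the length; around a peak k + 1/2 the same
    applies to the tents of the next level, for which 2k + 1 is a zero. *)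
Lemma tent_step_nonflat (M : nat) u t : 0 <= u -> t <= M%:R ->
  8^-1 < t - u -> t - u <= 4^-1 ->
  (exists2 k, (k < M)%N &
    16^-1 <= `|faber_schauder00 (t - k%:R) - faber_schauder00 (u - k%:R)|) \/
  (exists2 k, (k < 2 * M)%N &
    16^-1 <= `|faber_schauder00 (2 * t - k%:R) - faber_schauder00 (2 * u - k%:R)|).
Proof.
move=> u0 tM h1 h2; set K := Num.truncn u.
have /andP[K1] := truncn_itv u0; rewrite -/K -natr1 => K2.
have KM : (K < M)%N by rewrite -(ltr_nat R); lra.
have K2M : (2 * K < 2 * M)%N by rewrite ltn_mul2l.
(* With K the integer part of u, the cases are: the step lies on the rising side
   of tent K, crosses K + 1, lies on the falling side, or crosses the peak. *)
have [c1|c1] := leP (t - K%:R) (2^-1).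
  left; exists K => //; rewrite ler_normr tent_up ?tent_up; [|lra..].
  by apply/orP; left; lra.
have [c2|c2] := leP (t - K%:R) 1; last first.
  have [c3|c3] := leP (16^-1) (t - K%:R - 1).
    left; exists K.+1; first by rewrite -(ltr_nat R) -natr1; lra.
    rewrite ler_normr -[K.+1%:R]natr1 tent_up ?tent_left; [|lra..].
    by apply/orP; left; lra.
  left; exists K => //; rewrite ler_normr tent_right ?tent_down; [|lra..].
  by apply/orP; right; lra.
have [c3|c3] := leP (2^-1) (u - K%:R).
  left; exists K => //; rewrite ler_normr tent_down ?tent_down; [|lra..].
  by apply/orP; right; lra.
right; have [c4|c4] := leP (16^-1) (2 * t - 2 * K%:R - 1).
  exists (2 * K).+1; first by rewrite !mul2n -doubleS leq_double.
  rewrite ler_normr -[(2 * K).+1%:R]natr1 natrM tent_up ?tent_left; [|lra..].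
  by apply/orP; left; lra.
exists (2 * K)%N => //; rewrite ler_normr natrM tent_right ?tent_down; [|lra..].
by apply/orP; right; lra.
Qed.

Lemma dyadic_scale (x : R) : 0 < x -> x <= 4^-1 ->
  exists m, 8^-1 < 2 ^+ m * x /\ 2 ^+ m * x <= 4^-1.
Proof.
move=> x0 x4.
have ex : exists m, 8^-1 < 2 ^+ m * x.
  have /truncn_itv/andP[_] : 0 <= 8^-1 / x by rewrite divr_ge0// ltW.
  set n := Num.truncn _ => h; exists n.+1.
  rewrite -ltr_pdivrMr//; apply: (lt_le_trans h).
  by rewrite -natrX ler_nat ltnW// ltn_expl.
exists (ex_minn ex); case: ex_minnP => -[|m] h1 h2;
  first by rewrite expr0 mul1r in h1 *.
split => //; have := h2 m; rewrite ltnn exprS => h3.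
by have [/h3//|] := ltP (8^-1) (2 ^+ m * x); lra.
Qed.

(** At the scale m of dyadic_scale, 2^m (t - u) lies in (1/8, 1/4], so 2^(-mH) is at
    least (t - u)^H; passing to level m + 1 keeps this valid. *)
Lemma exists_large_coefficient H u t : 0 < H -> 0 <= u -> u < t -> t <= 1 ->
  t - u <= 4^-1 ->
  exists j : node, 16^-1 * (t - u) `^ H <= `|hat H j t - hat H j u|.
Proof.
move=> H0 u0 ut t1 tu4; have tu : 0 < t - u by lra.
have [m [m8 m4]] := dyadic_scale tu tu4.
have scale_le n (c : R) : (2 ^+ n * (t - u) <= 1) -> 16^-1 <= c ->
    16^-1 * (t - u) `^ H <= (2 `^ (- H)) ^+ n * c.
  move=> hn hc; rewrite mulrC ler_pM ?powR_ge0//.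
  have -> : (2 `^ (- H)) ^+ n = (2 ^+ n)^-1 `^ H :> R.
    rewrite -powR_mulrn ?powR_ge0// -powRrM -powR_inv1 ?exprn_ge0//.
    by rewrite -powR_mulrn// -!powRrM; congr (_ `^ _); ring.
  rewrite ge0_ler_powR ?nnegrE ?invr_ge0 ?exprn_ge0//; try lra.
  by rewrite -[leRHS]mul1r ler_pdivlMr ?exprn_gt0// mulrC.
have hatE (j : node) : `|hat H j t - hat H j u| = (2 `^ (- H)) ^+ tag j *
   `|faber_schauder00 (2 ^+ tag j * t - (tagged j)%:R) -
     faber_schauder00 (2 ^+ tag j * u - (tagged j)%:R)|.
  by rewrite /hat -mulrBr normrM (gtr0_norm (ratioX_gt0 _ _)).
have u0' : 0 <= 2 ^+ m * u by rewrite mulr_ge0// exprn_ge0.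
have t1' : 2 ^+ m * t <= (2 ^ m)%:R by rewrite natrX ler_piMr// exprn_ge0.
rewrite mulrBr in m8 m4.
have [[k km hk]|[k km hk]] := tent_step_nonflat u0' t1' m8 m4.
  exists (Tagged (fun n => 'I_(2 ^ n)) (Ordinal km)); rewrite hatE /=.
  by apply: scale_le => //; rewrite mulrBr; lra.
rewrite -expnS in km.
exists (Tagged (fun n => 'I_(2 ^ n)) (Ordinal km)); rewrite hatE /=.
by apply: scale_le; rewrite !exprS -?mulrA ?mulrBr//; lra.
Qed.

End hats.

(** * Influence of a single sign *)

Section influence.
Context {R : realType}.
Implicit Types (H : R) (s : seq R).

(** Up to a constant, the most that flipping the sign of node j can change the
    variation of exponent 1/H along s; see partial_tl_bounded_difference. *)
Definition influence H s (j : node) : R :=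
  \sum_(0 <= i < size s) step s i `^ (1 - H) *
    `|hat H j (partition_pt s i.+1) - hat H j (partition_pt s i)|.

Lemma influence_ge0 H s j : 0 <= influence H s j.
Proof. by apply: sumr_ge0 => i _; rewrite mulr_ge0 ?powR_ge0. Qed.

Lemma influence_le H s j : H < 1 -> itv_partition 0 1 s ->
  influence H s j <= mesh s `^ (1 - H) * (2 `^ (- H)) ^+ tag j.
Proof.
move=> H1 hs; apply: (@le_trans _ _ (mesh s `^ (1 - H) *
  \sum_(0 <= i < size s)
    `|hat H j (partition_pt s i.+1) - hat H j (partition_pt s i)|)).
  rewrite mulr_sumr; apply: ler_sum_nat => i /andP[_ si].
  rewrite ler_wpM2r// ge0_ler_powR ?nnegrE ?step_le_mesh//; try lra.
    exact/ltW/step_gt0.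
  exact/ltW/mesh_gt0.
rewrite ler_wpM2l ?powR_ge0//; apply: hat_path_le => i si.
exact/ltW/partition_ptS.
Qed.

(** One factor of each square is bounded uniformly over its level by influence_le,
    the other is summed over the level by sum_hatB_le; level_sum_le then adds up the
    levels for each step.  The exponents combine as
    min(1, 2 - 2H) = (1 - H) + (min(1, 2H) - H). *)
Lemma sum_influence_sq_le H : 0 < H < 1 -> H != 2^-1 ->
  exists2 C : R, 0 < C & forall s N, itv_partition 0 1 s ->
    \sum_(j <- nodes N) influence H s j ^+ 2
      <= C * mesh s `^ (Num.min 1 (2 - 2 * H)).
Proof.
move=> H01 Hh; have [C C0 hC] := level_sum_le H01 Hh.
case/andP: H01 => H0 H1.
exists (2 * C); first by rewrite mulr_gt0.
move=> s N hs; set h := mesh s.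
have h0 : 0 < h := mesh_gt0 hs.
set mu := Num.min 1 (2 * H).
have kE : Num.min 1 (2 - 2 * H) = (1 - H) + (mu - H).
  by rewrite /mu; case: (leP 1 (2 - 2 * H)) => h1; case: (leP 1 (2 * H)) => h2; lra.
have muH : 0 <= mu - H by rewrite /mu; case: (leP 1 (2 * H)) => h2; lra.
rewrite kE (powRD_gt0 _ _ h0).
apply: (@le_trans _ _ (\sum_(j <- nodes N)
   h `^ (1 - H) * ((2 `^ (- H)) ^+ tag j * influence H s j))).
  apply: ler_sum => j _; rewrite expr2 mulrA ler_wpM2r ?influence_ge0//.
  exact: influence_le.
rewrite -mulr_sumr mulrCA ler_pM2l ?powR_gt0//.
pose delta i m (k : 'I_(2 ^ m)) : R :=
  `|hat H (Tagged (fun n => 'I_(2 ^ n)) k) (partition_pt s i.+1) -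
    hat H (Tagged (fun n => 'I_(2 ^ n)) k) (partition_pt s i)|.
have -> : \sum_(j <- nodes N) (2 `^ (- H)) ^+ tag j * influence H s j =
  \sum_(0 <= i < size s) step s i `^ (1 - H) *
     \sum_(m < N) (2 `^ (- H)) ^+ m * \sum_(k < 2 ^ m) delta i m k.
  rewrite sum_nodes /=.
  under eq_bigr => m _ do under eq_bigr => k _ do
    rewrite /influence mulr_sumr.
  under eq_bigr => m _ do rewrite exchange_big /=.
  rewrite exchange_big /=; apply: eq_bigr => i _.
  rewrite mulr_sumr; apply: eq_bigr => m _.
  rewrite !mulr_sumr; apply: eq_bigr => k _.
  by rewrite /delta; ring.
apply: (@le_trans _ _ (\sum_(0 <= i < size s) step s i * (2 * C * h `^ (mu - H)))).
  apply: ler_sum_nat => i /andP[_ si].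
  have d0 : 0 < step s i := step_gt0 hs si.
  have dh : step s i <= h := step_le_mesh si.
  have d1 : step s i <= 1.
    have /andP[a1 _] := partition_pt_itv hs (ltnW si).
    by have /andP[_ a2] := partition_pt_itv hs si; rewrite /step; lra.
  apply: (@le_trans _ _ (step s i `^ (1 - H) * (2 * (C * step s i `^ mu)))).
    rewrite ler_wpM2l ?powR_ge0//.
    apply: (@le_trans _ _ (2 * \sum_(m < N)
       (2 `^ (- H)) ^+ (2 * m) * Num.min 1 (2 ^+ m * step s i))).
      rewrite mulr_sumr; apply: ler_sum => m _.
      apply: (@le_trans _ _ ((2 `^ (- H)) ^+ m *
        ((2 `^ (- H)) ^+ m * (2 * Num.min 1 (2 ^+ m * step s i))))).
        rewrite ler_wpM2l ?(ltW (ratioX_gt0 _ _))//.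
        by apply: sum_hatB_le; exact/ltW/partition_ptS.
      by rewrite mulrA -exprD addnn -mul2n [leRHS]mulrCA.
    by rewrite ler_pM2l//; apply: hC; rewrite d1 ltW.
  have -> : step s i `^ (1 - H) * (2 * (C * step s i `^ mu)) =
      2 * C * (step s i * step s i `^ (mu - H)).
    have E : step s i * step s i `^ (mu - H) =
        step s i `^ (1 - H) * step s i `^ mu.
      rewrite -(powRD_gt0 (1 - H) mu d0) (_ : 1 - H + mu = 1 + (mu - H)); last ring.
      by rewrite (powRD_gt0 1 (mu - H) d0) powRr1 ?ltW.
    by rewrite E; ring.
  rewrite [leRHS]mulrCA ler_pM2l ?mulr_gt0// ler_pM2l//.
  by rewrite ge0_ler_powR ?nnegrE// ltW.
by rewrite -mulr_suml sum_step// mul1r.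
Qed.

End influence.

(** * Power variation of the partial sums *)

Section variation_of_partial_sums.
Context {R : realType}.
Implicit Types (H p L : R) (s : seq R) (x : R -> R) (f : node -> R).

Definition holder_on01 H L x : Prop :=
  forall u t : R, 0 <= u <= 1 -> 0 <= t <= 1 -> `|x t - x u| <= L * `|t - u| `^ H.

Lemma holder_step H L x s i : holder_on01 H L x -> itv_partition 0 1 s ->
  (i < size s)%N ->
  `|x (partition_pt s i.+1) - x (partition_pt s i)| <= L * step s i `^ H.
Proof.
move=> hx hs si; rewrite -(gtr0_norm (step_gt0 hs si)).
by apply: hx; apply: partition_pt_itv => //; exact: ltnW.
Qed.

Lemma power_variation_holder_le H q L x s : 0 <= q -> 0 <= L ->
  holder_on01 H L x -> itv_partition 0 1 s ->
  power_variation q x s <= L `^ q * \sum_(0 <= i < size s) step s i `^ (H * q).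
Proof.
move=> q0 L0 hx hs; rewrite /power_variation mulr_sumr.
apply: ler_sum_nat => i /andP[_ si].
rewrite powRrM -powRM ?powR_ge0//.
rewrite ge0_ler_powR ?nnegrE ?mulr_ge0 ?powR_ge0//; exact: holder_step.
Qed.

Lemma power_variation_holder_le_pow H L x s : 0 < H -> 0 <= L ->
  holder_on01 H L x -> itv_partition 0 1 s ->
  power_variation H^-1 x s <= L `^ H^-1.
Proof.
move=> H0 L0 hx hs; have H'0 : 0 <= H^-1 by rewrite invr_ge0 ltW.
apply: le_trans (power_variation_holder_le H'0 L0 hx hs) _.
rewrite big_nat (eq_bigr (step s)); last first.
  by move=> i /andP[_ si]; rewrite divff ?gt_eqF// powRr1// ltW// step_gt0.
by rewrite -big_nat sum_step// mulr1.
Qed.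

(** The mean value inequality for the power 1/H, applied to increments of size
    at most L d^H; the weight d^(1-H) is (d^H)^(1/H - 1). *)
Lemma power_variationB_le H L x y s : 0 < H < 1 -> 0 <= L ->
  holder_on01 H L x -> holder_on01 H L y -> itv_partition 0 1 s ->
  `|power_variation H^-1 x s - power_variation H^-1 y s| <=
  H^-1 * L `^ (H^-1 - 1) * \sum_(0 <= i < size s) step s i `^ (1 - H) *
    `|(x (partition_pt s i.+1) - y (partition_pt s i.+1)) -
      (x (partition_pt s i) - y (partition_pt s i))|.
Proof.
move=> /andP[H0 H1] L0 hx hy hs; rewrite /power_variation -sumrB.
apply: le_trans (ler_norm_sum _ _ _) _.
rewrite mulr_sumr; apply: ler_sum_nat => i /andP[_ si].
have p1 : 1 < H^-1 by rewrite invf_gt1.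
apply: le_trans (normr_powRB_le p1 (holder_step hx hs si) (holder_step hy hs si)) _.
rewrite powRM ?powR_ge0// -powRrM.
rewrite (_ : H * (H^-1 - 1) = 1 - H); last by field; rewrite gt_eqF.
rewrite !mulrA le_eqVlt; apply/orP; left; apply/eqP; congr (_ * `|_|); ring.
Qed.

Lemma partial_tl_bounded_difference H L N s (j : node) : 0 < H < 1 -> 0 <= L ->
  (forall f, signs f -> holder_on01 H L (partial_tl H N f)) ->
  itv_partition 0 1 s -> (tag j < N)%N ->
  bounded_difference (fun f => power_variation H^-1 (partial_tl H N f) s) j
    (2 * (H^-1 * L `^ (H^-1 - 1)) * influence H s j).
Proof.
move=> H01 L0 hL hs jN f g sf sg fg.
apply: le_trans (power_variationB_le H01 L0 (hL _ sf) (hL _ sg) hs) _.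
have /andP[H0 H1] := H01.
set K := H^-1 * _; have K0 : 0 <= K.
  by rewrite mulr_ge0 ?powR_ge0// invr_ge0 ltW.
rewrite (_ : 2 * K * influence H s j = K * (2 * influence H s j)); last ring.
rewrite ler_wpM2l// /influence mulr_sumr; apply: ler_sum => i _.
rewrite !(partial_tlB H _ jN fg) -mulrBr normrM mulrCA.
rewrite ler_wpM2r// ?mulr_ge0 ?powR_ge0//.
by case: (sf j) (sg j) => -> [] ->; rewrite ler_norml; lra.
Qed.

(** Each step is assigned a node with a large coefficient; the level M is one
    beyond all these nodes.  Averaging over the sign of that node alone already
    gives 16^(-1/H) / 2 times the length of the step, and the lengths add up
    to 1. *)
Lemma sign_mean_power_variation_ge H s : 0 < H < 1 -> itv_partition 0 1 s ->
  mesh s <= 4^-1 ->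
  exists M, forall N f, (M <= N)%N -> signs f ->
    16^-1 `^ H^-1 / 2 <= 
    sign_mean (nodes N) (fun g => power_variation H^-1 (partial_tl H N g) s) f.
Proof.
move=> /andP[H0 H1] hs hm.
have ex (i : 'I_(size s)) : exists j : node, 16^-1 * step s i `^ H <=
    `|hat H j (partition_pt s i.+1) - hat H j (partition_pt s i)|.
  have /andP[a1 _] := partition_pt_itv hs (ltnW (ltn_ord i)).
  have /andP[_ a2] := partition_pt_itv hs (ltn_ord i).
  apply: exists_large_coefficient => //; first exact: partition_ptS.
  exact: le_trans (step_le_mesh (ltn_ord i)) hm.
have [j hj] := choice ex.
exists (\max_(i < size s) (tag (j i)).+1)%N => N f MN sf.
rewrite /power_variation sign_mean_sum big_mkord.
apply: (@le_trans _ _ (\sum_(i < size s) step s i * (16^-1 `^ H^-1 / 2))).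
  by rewrite -mulr_suml -(big_mkord xpredT (step s)) sum_step// mul1r.
apply: ler_sum => i _; have jN : (tag (j i) < N)%N.
  by apply: leq_trans MN; exact: (leq_bigmax i).
apply: (@sign_mean_ge _ _ _ _ _ (j i)) => //; first by rewrite mem_nodes.
move=> g sg; have H'0 : 0 <= H^-1 by rewrite invr_ge0 ltW.
set a := hat H (j i) (partition_pt s i.+1) - hat H (j i) (partition_pt s i).
set y := partial_tl H N (upd g (j i) 0) (partition_pt s i.+1) -
  partial_tl H N (upd g (j i) 0) (partition_pt s i).
rewrite !(partial_tl_upd H g 1 _ jN) !(partial_tl_upd H g (-1) _ jN).
have E1 u v b c : u + 1 * b - (v + 1 * c) = (u - v) + (b - c) :> R by ring.
have E2 u v b c : u + -1 * b - (v + -1 * c) = (u - v) - (b - c) :> R by ring.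
rewrite E1 E2 -/a -/y; apply: le_trans (half_powR_le_symm a y H'0).
have d0 : 0 < step s i := step_gt0 hs (ltn_ord i).
rewrite mulrA ler_pM2r ?invr_gt0//.
have -> : step s i * 16^-1 `^ H^-1 = (16^-1 * step s i `^ H) `^ H^-1.
  rewrite powRM ?powR_ge0 ?invr_ge0// -powRrM divff ?gt_eqF// powRr1 ?ltW//.
  exact: mulrC.
by rewrite ge0_ler_powR ?nnegrE ?mulr_ge0 ?powR_ge0 ?invr_ge0// ltW.
Qed.

End variation_of_partial_sums.

(** * Truncation of the series *)

Section truncation.
Context {R : realType}.
Implicit Types (H L t : R) (theta : dyadic_array R) (f : node -> R).

Definition flatten_array (T : Type) (theta : dyadic_array T) (j : node) : T :=
  theta (tag j) (tagged j).

Definition array_of (f : node -> R) : dyadic_array R :=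
  fun n k => f (Tagged (fun n => 'I_(2 ^ n)) k).

Lemma array_ofK f : flatten_array (array_of f) = f.
Proof. by apply/funext => -[]. Qed.

Lemma array_of_sign f : signs f -> is_sign_array (array_of f).
Proof. by move=> sf n k; exact: sf. Qed.

Let term H theta t n : R := 2 `^ (n%:R * (2^-1 - H)) *
    \sum_(k < 2 ^ n) theta n k * faber_schauder n k t.

Lemma termE H theta t n : term H theta t n =
  \sum_(k < 2 ^ n) theta n k * hat H (Tagged (fun n => 'I_(2 ^ n)) k) t.
Proof.
rewrite /term mulr_sumr; apply: eq_bigr => k _; rewrite /faber_schauder /hat /=.
rewrite mulrCA; congr (_ * _); rewrite mulrA; congr (_ * _).
rewrite -powRD_gt0// -powR_mulrn ?powR_ge0// -powRrM; congr (_ `^ _).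
by field.
Qed.

Lemma series_termE H theta t N :
  series (term H theta t) N = partial_tl H N (flatten_array theta) t.
Proof.
rewrite /partial_tl sum_nodes seriesEnat /= big_mkord.
by apply: eq_bigr => m _; rewrite termE.
Qed.

Lemma ratio_lt1 H : 0 < H -> 2 `^ (- H) < 1 :> R.
Proof. by move=> H0; rewrite powR2_lt1// oppr_lt0. Qed.

Lemma term_le H f t n : signs f -> `|term H (array_of f) t n| <= (2 `^ (- H)) ^+ n.
Proof.
move=> sf; rewrite termE; apply: le_trans (ler_norm_sum _ _ _) _.
apply: le_trans (sum_hat_le H n t); apply: ler_sum => k _.
rewrite normrM (ger0_norm (hat_ge0 _ _ _)).
by case: (array_of_sign sf k) => ->; rewrite ?normrN normr1 mul1r.
Qed.

Lemma partial_tl_cvg H f t : 0 < H -> signs f ->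
  partial_tl H N f t @[N --> \oo] --> takagi_landsberg H (array_of f) t.
Proof.
move=> H0 sf.
have -> : (fun N => partial_tl H N f t) = series (term H (array_of f) t).
  by apply/funext => N; rewrite series_termE array_ofK.
apply: normed_cvg.
apply: (@series_le_cvg _ _ (geometric 1 (2 `^ (- H)))).
- by move=> n; exact: normr_ge0.
- by move=> n; rewrite /geometric /= mul1r exprn_ge0// powR_ge0.
- by move=> n; rewrite /geometric /= mul1r term_le.
apply: is_cvg_geometric_series.
by rewrite ger0_norm ?powR_ge0// ratio_lt1.
Qed.

(** The sum of the geometric series r^N + r^(N+1) + ... for r = 2^(-H). *)
Definition tail_bound H N : R := (2 `^ (- H)) ^+ N / (1 - 2 `^ (- H)).

Lemma partial_tl_tail_le H f t N M : 0 < H -> signs f -> (N <= M)%N ->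
  `|partial_tl H M f t - partial_tl H N f t| <= tail_bound H N.
Proof.
move=> H0 sf NM; rewrite -(array_ofK f) -!series_termE sub_series_geq//.
apply: le_trans (ler_norm_sum _ _ _) _.
apply: (@le_trans _ _ (\sum_(N <= i < M) (2 `^ (- H)) ^+ i)).
  by apply: ler_sum => i _; exact: term_le.
rewrite -{1}(subnKC NM) geometric_partial_tail.
apply: geometric_le_lim; rewrite ?exprn_ge0 ?powR_ge0 ?powR_gt0//.
by rewrite ger0_norm ?powR_ge0// ratio_lt1.
Qed.

Lemma takagi_landsberg_tail_le H f t N : 0 < H -> signs f ->
  `|takagi_landsberg H (array_of f) t - partial_tl H N f t| <= tail_bound H N.
Proof.
move=> H0 sf.
have hN : `|partial_tl H M f t - partial_tl H N f t| @[M --> \oo] -->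
    `|takagi_landsberg H (array_of f) t - partial_tl H N f t|.
  by apply: cvg_norm; apply: cvgB; [exact: partial_tl_cvg|exact: cvg_cst].
rewrite -(cvg_lim _ hN)//.
apply: limr_le; first exact: cvgP hN.
near=> M; apply: partial_tl_tail_le => //.
by near: M; exact: nbhs_infty_ge.
Unshelve. all: by end_near. Qed.

Lemma tail_bound_cvg0 H : 0 < H -> tail_bound H N @[N --> \oo] --> 0.
Proof.
move=> H0; rewrite -(mul0r (1 - 2 `^ (- H))^-1).
apply: cvgMr_tmp; apply: cvg_expr.
by rewrite ger0_norm ?powR_ge0// ratio_lt1.
Qed.

Lemma holder_constant_ge0 H L : uniform_holder_constant H L -> 0 <= L.
Proof.
move=> hL; have := hL (fun n k => 1) (fun n k => or_introl erefl) 0 1.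
rewrite !lexx ler01 subr0 normr1 powR1 mulr1 => /(_ isT isT).
by apply: le_trans.
Qed.

(** The array f' agrees with f below level N and is opposite to f from there on, so
    the two series average to the partial sum of f; both have Holder
    constant L. *)
Lemma partial_tl_holder H L N f : 0 < H -> uniform_holder_constant H L ->
  signs f -> holder_on01 H L (partial_tl H N f).
Proof.
move=> H0 hL sf u t u01 t01.
pose f' (j : node) := if (tag j < N)%N then f j else - f j.
have sf' : signs f'.
  move=> j; rewrite /f'; case: ifP => _; first exact: sf.
  by case: (sf j) => ->; rewrite ?opprK; [right|left].
have avg x : takagi_landsberg H (array_of f) x + takagi_landsberg H (array_of f') x
    = 2 * partial_tl H N f x.
  have h : (partial_tl H M f x + partial_tl H M f' x) @[M --> \oo] -->
      takagi_landsberg H (array_of f) x + takagi_landsberg H (array_of f') x.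
    by apply: cvgD; exact: partial_tl_cvg.
  have h' : (partial_tl H M f x + partial_tl H M f' x) @[M --> \oo] -->
      2 * partial_tl H N f x.
    apply: cvg_near_cst; near=> M.
    have NM : (N <= M)%N by near: M; exact: nbhs_infty_ge.
    rewrite /partial_tl -big_split /= !sum_nodes.
    rewrite -(subnKC NM) big_split_ord /= [X in _ + X]big1 ?addr0; last first.
      move=> i _; apply: big1 => k _.
      by rewrite /f' /= ltnNge leq_addr /= -mulrDl subrr mul0r.
    rewrite mulr_sumr; apply: eq_bigr => i _; rewrite mulr_sumr.
    apply: eq_bigr => k _.
    by rewrite /f' /= ltn_ord -mulrDl -mulr2n -[in LHS]mulr_natl mulrA.
  exact: (cvg_unique _ h h').
have a := hL _ (array_of_sign sf) u t u01 t01.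
have b := hL _ (array_of_sign sf') u t u01 t01.
have -> : partial_tl H N f t - partial_tl H N f u =
  ((takagi_landsberg H (array_of f) t - takagi_landsberg H (array_of f) u) +
   (takagi_landsberg H (array_of f') t - takagi_landsberg H (array_of f') u)) / 2.
  have at_ := avg t; have au := avg u; lra.
rewrite normrM (@ger0_norm _ 2^-1)// ler_pdivrMr//.
by apply: le_trans (ler_normD _ _) _; lra.
Unshelve. all: by end_near. Qed.

Lemma power_variation_truncation_le H L s N f : 0 < H < 1 ->
  uniform_holder_constant H L -> signs f -> itv_partition 0 1 s ->
  `|power_variation H^-1 (takagi_landsberg H (array_of f)) s -
    power_variation H^-1 (partial_tl H N f) s| <=
  H^-1 * L `^ (H^-1 - 1) * ((size s)%:R * (2 * tail_bound H N)).
Proof.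
move=> H01 hL sf hs; have L0 := holder_constant_ge0 hL.
have /andP[H0 H1] := H01.
have hX : holder_on01 H L (takagi_landsberg H (array_of f)).
  by move=> u t; apply: hL; exact: array_of_sign.
apply: le_trans (power_variationB_le H01 L0 hX (partial_tl_holder N H0 hL sf) hs) _.
have K0 : 0 <= H^-1 * L `^ (H^-1 - 1) by rewrite mulr_ge0 ?powR_ge0 ?invr_ge0 ?ltW.
rewrite ler_wpM2l//.
apply: (@le_trans _ _ (\sum_(0 <= i < size s) 2 * tail_bound H N)); last first.
  by rewrite sumr_const_nat subn0 -[leLHS]mulr_natl.
apply: ler_sum_nat => i /andP[_ si].
have /andP[a1 _] := partition_pt_itv hs (ltnW si).
have /andP[_ a2] := partition_pt_itv hs si.
have d0 := step_gt0 hs si.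
rewrite -[leRHS]mul1r ler_pM ?powR_ge0//.
  have d1 : step s i <= 1 by rewrite /step; lra.
  apply: (@le_trans _ _ (1 `^ (1 - H))); last by rewrite powR1.
  by rewrite ge0_ler_powR ?nnegrE ?(ltW d0)// subr_ge0 ltW.
apply: le_trans (ler_normB _ _) _.
rewrite mulr_natl mulr2n; apply: lerD; exact: takagi_landsberg_tail_le.
Qed.

End truncation.

Section truncated_variation.
Context {R : realType}.

Lemma partial_tl_depends (H : R) N t :
  depends_on (nodes N) (fun f : node -> R => partial_tl H N f t).
Proof.
move=> f g fg; rewrite /partial_tl !big_seq.
by apply: eq_bigr => j jN; rewrite fg.
Qed.

Lemma power_variation_partial_depends (H p : R) N s :
  depends_on (nodes N) (fun f : node -> R => power_variation p (partial_tl H N f) s).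
Proof.
move=> f g fg; apply: eq_bigr => i _.
by rewrite !(partial_tl_depends H _ fg).
Qed.

Lemma measurable_power_variation_partial {d : measure_display}
    {T : measurableType d} (H p : R) N s (X : node -> T -> R) :
  (forall j, measurable_fun setT (X j)) ->
  measurable_fun setT (fun w => power_variation p (partial_tl H N (X^~ w)) s).
Proof.
move=> mX; rewrite /power_variation; apply: measurable_sum => i.
apply: (measurableT_comp (measurable_powR p)); apply: measurableT_comp => //.
by apply: measurable_funB; apply: measurable_sum => j; exact: measurable_funM.
Qed.

Lemma truncation_level (H L eps : R) (s : seq R) : 0 < H < 1 ->
  uniform_holder_constant H L -> itv_partition 0 1 s -> 0 < eps ->
  exists N,
    (forall f, signs f ->
      `|power_variation H^-1 (takagi_landsberg H (array_of f)) s -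
        power_variation H^-1 (partial_tl H N f) s| <= eps) /\
    (mesh s <= 4^-1 -> forall f, signs f -> 16^-1 `^ H^-1 / 2 <=
      sign_mean (nodes N) (fun g => power_variation H^-1 (partial_tl H N g) s) f).
Proof.
move=> H01 hL hs eps0; have L0 := holder_constant_ge0 hL.
have /andP[H0 H1] := H01.
set K := H^-1 * L `^ (H^-1 - 1) * ((size s)%:R * 2) + 1.
have K0 : 0 < K.
  by rewrite ltr_wpDl// mulr_ge0 ?mulr_ge0 ?powR_ge0 ?invr_ge0 ?(ltW H0).
have /cvgrPdist_le/(_ (eps / K) (divr_gt0 eps0 K0)) ht := tail_bound_cvg0 H0.
have [M hM] : exists M, mesh s <= 4^-1 -> forall N f, (M <= N)%N -> signs f ->
    16^-1 `^ H^-1 / 2 <= sign_mean (nodes N)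
      (fun g => power_variation H^-1 (partial_tl H N g) s) f.
  have [ms|_] := leP (mesh s) (4^-1); last by exists 0%N.
  by have [M hM] := sign_mean_power_variation_ge H01 hs ms; exists M.
near \oo => N; exists N; split => [f sf|ms f sf].
  apply: le_trans (power_variation_truncation_le N H01 hL sf hs) _.
  have : tail_bound H N <= eps / K.
    by apply: (@le_trans _ _ `|0 - tail_bound H N|);
      [rewrite sub0r normrN ler_norm|near: N].
  rewrite ler_pdivlMr// => h.
  have t0 : 0 <= tail_bound H N.
    rewrite /tail_bound divr_ge0// ?exprn_ge0 ?powR_ge0// subr_ge0 ltW//.
    exact: ratio_lt1.
  apply: le_trans h; rewrite [leLHS](_ : _ = tail_bound H N * (K - 1)).
    by rewrite ler_wpM2l// gerBl.
  by rewrite /K; ring.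
by apply: hM => //; near: N; exact: nbhs_infty_ge.
Unshelve. all: by end_near. Qed.

End truncated_variation.

(** * Upper and lower limits, and Borel-Cantelli *)

Section limits.
Context {R : realType}.
Implicit Types (u : nat -> R).

Lemma limn_esup_le_near (v : nat -> \bar R) (l : \bar R) :
  (\forall n \near \oo, (v n <= l)%E) -> (limn_esup v <= l)%E.
Proof.
move=> h; apply: (@le_trans _ _ (ereal_sup (v @` [set n | v n <= l]%E))).
  by apply: ereal_inf_lbound; exists [set n | v n <= l]%E.
by apply: ge_ereal_sup => _ [n /= hn <-].
Qed.

Lemma limn_einf_ge_near (v : nat -> \bar R) (l : \bar R) :
  (\forall n \near \oo, (l <= v n)%E) -> (l <= limn_einf v)%E.
Proof.
move=> h; rewrite /limn_einf leeNr; apply: limn_esup_le_near.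
by near=> n; rewrite leeNl oppeK; near: n.
Unshelve. all: by end_near. Qed.

Lemma limn_esup_lt_near (v : nat -> \bar R) (l : \bar R) :
  (limn_esup v < l)%E -> \forall n \near \oo, (v n < l)%E.
Proof.
move=> /ereal_inf_lt[_ [A FA <-] h].
apply: filterS FA => n An; apply: le_lt_trans h.
by apply: ereal_sup_ubound; exists n.
Qed.

Lemma squares_telescope (n : nat) : (4 <= n)%N ->
  2 * n%:R ^- 2 <= 4 / n.+1%:R - 4 / n.+2%:R :> R.
Proof.
move=> n4; have n4' : 4 <= n%:R :> R by rewrite ler_nat.
rewrite -[n.+2%:R]natr1 -[n.+1%:R]natr1; set x : R := n%:R in n4' *.
have -> : 4 / (x + 1) - 4 / (x + 1 + 1) = 4 / ((x + 1) * (x + 2)).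
  by field; apply/andP; split; rewrite gt_eqF//; lra.
have h1 : 0 < (x + 1) * (x + 2) by rewrite mulr_gt0//; lra.
have h2 : 0 < x ^+ 2 by rewrite exprn_gt0//; lra.
rewrite ler_pdivlMr// mulrAC ler_pdivrMr//; nra.
Qed.

End limits.

Section borel_cantelli.
Context {d : measure_display} {T : measurableType d} {R : realType}
  (P : probability T R).

(** Borel-Cantelli, with the convergent series of 1 / n^2 dominated by a
    telescoping one. *)
Lemma ae_near_notin (A : nat -> set T) : (forall n, measurable (A n)) ->
  (\forall n \near \oo, (P (A n) <= (2 * n%:R ^- 2)%:E)%E) ->
  \forall w \ae P, \forall n \near \oo, ~ A n w.
Proof.
move=> mA [n0 _ hn0].
set n1 := maxn n0 4.
pose B n := if (n1 <= n)%N then A n else set0.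
have mB n : measurable (B n) by rewrite /B; case: ifP.
have PB n : (P (B n) <= (4 / n.+1%:R - 4 / n.+2%:R)%:E)%E.
  rewrite /B; case: ifP => [|_].
    rewrite geq_max => /andP[n0n n4]; apply: le_trans (hn0 n n0n) _.
    by rewrite lee_fin squares_telescope.
  rewrite measure0 lee_fin subr_ge0 ler_pM2l// lef_pV2 ?posrE//.
  by rewrite ler_nat.
have sumB n : (\sum_(0 <= k < n) P (B k) <= (4 - 4 / n.+1%:R)%:E)%E.
  elim: n => [|n IH]; first by rewrite big_nil divr1 subrr.
  rewrite big_nat_recr//=; apply: le_trans (leeD IH (PB n)) _.
  by rewrite -EFinD lee_fin addrA subrK.
have : (\sum_(0 <= n <oo) P (B n) < +oo)%E.
  apply: (@le_lt_trans _ _ 4%:E); last exact: ltry.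
  apply: lime_le; first by apply: is_cvg_nneseries.
  apply: nearW => n; apply: le_trans (sumB n) _.
  by rewrite lee_fin gerBl divr_ge0.
move=> /(lim_sup_set_cvg0 mB) PB0.
exists (lim_sup_set B); split => //.
  by apply: bigcapT_measurable => n; apply: bigcup_measurable.
move=> w /=; apply: contra_notP => hw.
have [n h] : exists n, ~ (\bigcup_(j >= n) B j) w.
  by apply: contrapT => /forallNP h; apply: hw => n _; apply: contrapT; exact: h.
exists (maxn n n1) => // m /=; rewrite geq_max => /andP[nm n1m] Am.
by apply: h; exists m => //; rewrite /B n1m.
Qed.

End borel_cantelli.

(** * The variation index *)

Section variation_index.
Context {R : realType}.

Lemma power_variation_le_exponent (x : R -> R) (s : seq R) (q p : R) :
  0 < q -> q <= p ->
  (forall i, (i < size s)%N ->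
    `|x (partition_pt s i.+1) - x (partition_pt s i)| <= 1) ->
  power_variation p x s <= power_variation q x s.
Proof.
move=> q0 qp h; apply: ler_sum_nat => i /andP[_ si].
have := h i si; set a := `|_| => a1.
have [a0|a0] := eqVneq a 0.
  by rewrite a0 !powR0 ?gt_eqF//; exact: lt_le_trans qp.
by rewrite ger_powR// a1 andbT lt_def a0 normr_ge0.
Qed.

(** Exponents q > 1/H belong to the set defining the index because the variation of
    exponent q is at most L^q mesh^(qH - 1).  An exponent q < 1/H does not: once all
    increments are at most 1, the variation of exponent q is at least that of
    exponent 1/H, hence at least c. *)
Lemma variation_index_holder (H L c : R) (x : R -> R) (pi : nat -> seq R) :
  0 < H < 1 -> 0 <= L -> 0 < c -> holder_on01 H L x ->
  (forall n, (1 <= n)%N -> itv_partition 0 1 (pi n)) ->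
  (forall e, 0 < e -> \forall n \near \oo, mesh (pi n) <= e) ->
  (\forall n \near \oo, c <= power_variation H^-1 x (pi n)) ->
  variation_index pi x = H^-1%:E.
Proof.
move=> /andP[H0 H1] L0 c0 hx hpi hmesh hc.
have p1 : 1 < H^-1 by rewrite invf_gt1.
apply/eqP; rewrite eq_le; apply/andP; split.
  apply/lee_addgt0Pr => e e0; rewrite -EFinD; apply: ereal_inf_lbound.
  exists (H^-1 + e) => //; split; first lra.
  set q := H^-1 + e.
  have q0 : 0 <= q by rewrite /q; lra.
  have HqE : H * q = 1 + H * e by rewrite /q mulrDr divff ?gt_eqF.
  have He0 : 0 < H * e by rewrite mulr_gt0.
  suff : (power_variation q x (pi n))%:E @[n --> \oo] --> 0%:E.
    by move=> /cvg_limn_einf_sup[_ ->].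
  apply: cvg_EFin; first by near=> n.
  set K := L `^ q + 1.
  have K0 : 0 < K by rewrite /K; have := powR_ge0 L q; lra.
  apply/cvgrPdist_le => eps eps0; near=> n.
  rewrite /= sub0r normrN ger0_norm; last first.
    by apply: sumr_ge0 => i _; rewrite powR_ge0.
  have hs : itv_partition 0 1 (pi n) by apply: hpi; near: n; exact: nbhs_infty_ge.
  apply: le_trans (power_variation_holder_le q0 L0 hx hs) _.
  have hm : mesh (pi n) <= (eps / K) `^ (H * e)^-1.
    by near: n; apply: hmesh; rewrite powR_gt0// divr_gt0.
  have m0 := mesh_gt0 hs.
  have hm' : mesh (pi n) `^ (H * e) <= eps / K.
    have -> : eps / K = ((eps / K) `^ (H * e)^-1) `^ (H * e).
      by rewrite -powRrM mulVf ?gt_eqF// powRr1// divr_ge0 ?ltW.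
    by rewrite ge0_ler_powR ?nnegrE ?powR_ge0// ltW.
  apply: (@le_trans _ _ (L `^ q * (eps / K))); last first.
    rewrite mulrCA ler_piMr ?(ltW eps0)// ler_pdivrMr// mul1r /K; lra.
  rewrite ler_wpM2l ?powR_ge0//.
  apply: (@le_trans _ _ (\sum_(0 <= i < size (pi n)) step (pi n) i * (eps / K))).
    apply: ler_sum_nat => i /andP[_ si]; have d0 := step_gt0 hs si.
    rewrite HqE (powRD_gt0 _ _ d0) (powRr1 (ltW d0)) ler_pM2l//.
    apply: le_trans hm'; rewrite ge0_ler_powR ?nnegrE ?step_le_mesh//; exact: ltW.
  by rewrite -mulr_suml sum_step// mul1r.
apply: le_ereal_inf_tmp => _ [q [q1 hq] <-]; rewrite lee_fin leNgt; apply/negP => qp.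
have : (limn_esup (fun n => (power_variation q x (pi n))%:E) < c%:E)%E.
  by rewrite hq lte_fin.
move=> /limn_esup_lt_near hlt.
set K := L + 1; have K0 : 0 < K by rewrite /K; lra.
suff [n [h1 h2]] : exists n, c <= power_variation H^-1 x (pi n) /\
    power_variation H^-1 x (pi n) < c by lra.
near \oo => n; exists n; split; first by near: n.
have hs : itv_partition 0 1 (pi n) by apply: hpi; near: n; exact: nbhs_infty_ge.
have : power_variation q x (pi n) < c by rewrite -lte_fin; near: n.
apply: le_lt_trans; apply: power_variation_le_exponent; try lra.
move=> i si; apply: le_trans (holder_step hx hs si) _.
have hm : mesh (pi n) <= K^-1 `^ H^-1.
  by near: n; apply: hmesh; rewrite powR_gt0// invr_gt0.
apply: (@le_trans _ _ (L * K^-1)).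
  rewrite ler_wpM2l//; apply: (@le_trans _ _ ((K^-1 `^ H^-1) `^ H)).
    rewrite ge0_ler_powR ?nnegrE ?powR_ge0 ?(ltW H0) ?(ltW (step_gt0 hs si))//.
    exact: le_trans (step_le_mesh si) hm.
  by rewrite -powRrM mulVf ?gt_eqF// powRr1// invr_ge0 ltW.
by rewrite ler_pdivrMr// mul1r /K; lra.
Unshelve. all: by end_near. Qed.

End variation_index.

(** * Mesh rate and conclusion *)

Section mesh_rate.
Context {R : realType} (pi : nat -> seq R) (kappa : R).
Hypothesis kappa0 : 0 < kappa.
Hypothesis hmesh : (fun n => mesh (pi n)) =o_\oo
  (fun n => ln (n%:R : R) `^ (- kappa^-1)).

Lemma mesh_ge0 (s : seq R) : 0 <= mesh s.
Proof. by rewrite /mesh; apply: bigmax_ge_id. Qed.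

Lemma near_mesh_le_rate (e : R) : 0 < e ->
  \forall n \near \oo, mesh (pi n) <= e * ln n%:R `^ (- kappa^-1).
Proof.
move=> e0; have /eqoP/(_ e e0) h := hmesh.
by apply: filterS h => n; rewrite !ger0_norm ?mesh_ge0 ?powR_ge0.
Qed.

(** Beyond expR 1 the rate is at most 1, so the little-o condition also forces
    the mesh to tend to 0. *)
Lemma near_ln_ge1 : \forall n \near \oo, 1 <= ln n%:R :> R.
Proof.
near=> n; have h : expR 1 <= n%:R :> R by near: n; exact: nbhs_infty_ger.
by rewrite -ler_expR lnK// posrE (lt_le_trans (expR_gt0 _) h).
Unshelve. all: by end_near. Qed.

Lemma near_mesh_le (e : R) : 0 < e -> \forall n \near \oo, mesh (pi n) <= e.
Proof.
move=> e0; near=> n.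
have h1 : 1 <= ln n%:R :> R by near: n; exact: near_ln_ge1.
have h2 : mesh (pi n) <= e * ln n%:R `^ (- kappa^-1).
  by near: n; exact: near_mesh_le_rate.
apply: le_trans h2 _; rewrite ler_piMr ?(ltW e0)// powRN invf_le1.
  by apply: powR_ge1 => //; rewrite invr_ge0 ltW.
by rewrite powR_gt0// (lt_le_trans ltr01).
Unshelve. all: by end_near. Qed.

Lemma near_mesh_powR_le (a : R) : 0 < a ->
  \forall n \near \oo, mesh (pi n) `^ kappa <= a / ln n%:R.
Proof.
move=> a0; near=> n.
have h1 : 1 <= ln n%:R :> R by near: n; exact: near_ln_ge1.
have l0 : 0 <= ln n%:R :> R by apply: le_trans h1.
have h2 : mesh (pi n) <= a `^ kappa^-1 * ln n%:R `^ (- kappa^-1).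
  by near: n; apply: near_mesh_le_rate; rewrite powR_gt0.
have -> : a / ln n%:R = (a `^ kappa^-1 * ln n%:R `^ (- kappa^-1)) `^ kappa.
  rewrite powRM ?powR_ge0// -!powRrM mulNr mulVf ?gt_eqF//.
  by rewrite powRr1 ?(ltW a0)// powRN powRr1.
by rewrite ge0_ler_powR ?nnegrE ?mesh_ge0 ?mulr_ge0 ?powR_ge0// ltW.
Unshelve. all: by end_near. Qed.

End mesh_rate.

Unset Implicit Arguments.
Set Strict Implicit.

Theorem theorem2p10 (R : realType) (H : R) (H01 : 0 < H < 1)
    (Hhalf : H != 2^-1) :
  let p := H^-1 in
  let kappa := Num.min 1 (2 - 2 * H) in
  exists c : R, 0 < c /\
    forall (L : R) (_ : uniform_holder_constant H L)
      (d : measure_display) (T : measurableType d) (P : probability T R)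
      (theta : dyadic_array {RV P >-> R})
      (_ : independent_rademacher_array theta)
      (pi : nat -> seq R)
      (_ : forall n, (1 <= n)%N -> itv_partition 0 1 (pi n))
      (_ : (fun n => mesh (pi n)) =o_\oo
           (fun n => ln (n%:R : R) `^ (- kappa^-1))),
    let X := random_takagi_landsberg H theta in
    let V := fun (n : nat) (w : T) => power_variation p (X w) (pi n) in
    [/\ \forall n \near \oo, (c%:E <= 'E_P[V n] <= (L `^ p)%:E)%E,
        \forall w \ae P, ((V n w)%:E - 'E_P[V n])%E @[n --> \oo] --> 0%E,
        \forall w \ae P,
          [/\ (c%:E <= limn_einf (fun n => (V n w)%:E))%E,
              (limn_einf (fun n => (V n w)%:E)
                 <= limn_esup (fun n => (V n w)%:E))%E
            & (limn_esup (fun n => (V n w)%:E) <= (L `^ p)%:E)%E]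
      & \forall w \ae P, variation_index pi (X w) = p%:E].
Proof.
move=> p kappa; have /andP[H0 H1] := H01.
have kappa0 : 0 < kappa by rewrite /kappa lt_min ltr01; lra.
have [C C0 hC] := sum_influence_sq_le H01 Hhalf.
set c0 : R := 16^-1 `^ p / 2.
have c00 : 0 < c0 by rewrite divr_gt0// powR_gt0// invr_gt0.
exists (c0 / 4); split; first by rewrite divr_gt0.
move=> L hL d T P theta [rad indep] pi hpi hmesh X V.
have L0 := holder_constant_ge0 hL.
pose th : node -> {RV P >-> R} := flatten_array theta.
have rad' j : is_rademacher (th j) by exact: rad.
pose sample w : node -> R := fun j => th j w.
have XE w : X w = takagi_landsberg H (array_of (sample w)) by [].
have good := ae_signs (P := P) rad'.
(* The partition of index n is paired with a partial sum of level Nf n whose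
   variation F n is within eps n of V n: small compared with the lower bound c0 on
   the means, and tending to 0. *)
pose eps n : R := Num.min (c0 / 2) n.+1%:R^-1.
have eps0 n : 0 < eps n by rewrite lt_min divr_gt0//= invr_gt0.
have epsc n : eps n <= c0 / 2 by rewrite ge_min lexx.
have epsn n : eps n <= n.+1%:R^-1 by rewrite ge_min lexx orbT.
have lev n : exists N, (1 <= n)%N ->
    (forall f, signs f ->
      `|power_variation p (takagi_landsberg H (array_of f)) (pi n) -
        power_variation p (partial_tl H N f) (pi n)| <= eps n) /\
    (mesh (pi n) <= 4^-1 -> forall f, signs f -> c0 <=
      sign_mean (nodes N) (fun g => power_variation p (partial_tl H N g) (pi n)) f).
  case: n => [|n]; first by exists 0%N.
  by have [N hN] := truncation_level H01 hL (hpi n.+1 isT) (eps0 n.+1); exists N.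
have [Nf hN] := choice lev.
pose F n f := power_variation p (partial_tl H (Nf n) f) (pi n).
(* Any sign array could serve: the mean does not involve it on nodes (Nf n). *)
pose f0 : node -> R := fun=> 1.
have sf0 : signs f0 by move=> j; left.
pose m n := sign_mean (nodes (Nf n)) (F n) f0.
have F0 n g : 0 <= F n g by apply: sumr_ge0 => i _; rewrite powR_ge0.
have V0 n w : 0 <= V n w by apply: sumr_ge0 => i _; rewrite powR_ge0.
have mF n : measurable_fun setT (F n \o sample).
  by apply: measurable_power_variation_partial => j.
have dF n : depends_on (nodes (Nf n)) (F n).
  exact: power_variation_partial_depends.
have hV n w : (1 <= n)%N -> signs (sample w) -> `|V n w - F n (sample w)| <= eps n.
  by move=> n1 sw; have [h _] := hN n n1; exact: h.
have ex n : exists e, (1 <= n)%N -> ('E_P[V n] = e%:E)%E /\ `|e - m n| <= eps n.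
  case: n => [|n]; first by exists 0.
  have [] // := @expectation_near_sign_mean _ _ _ P _ th rad' indep
    (nodes (Nf n.+1)) (F n.+1) f0 (V n.+1) (eps n.+1).
  - exact: nodes_uniq.
  - exact: ltW.
  - by apply: filterS good => w sw; exact: hV.
  by move=> e he; exists e.
have [e he] := choice ex.
have hE n : (1 <= n)%N -> ('E_P[V n] = (e n)%:E)%E by move=> /he[].
have hem n : (1 <= n)%N -> `|e n - m n| <= eps n by move=> /he[].
have hmesh0 x : 0 < x -> \forall n \near \oo, mesh (pi n) <= x.
  by apply: near_mesh_le; [exact: kappa0|exact: hmesh].
have e_ge : \forall n \near \oo, c0 / 2 <= e n.
  near=> n; have n1 : (1 <= n)%N by near: n; exact: nbhs_infty_ge.
  have h1 : c0 <= m n.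
    have [_ h] := hN n n1; apply: h => //.
    by near: n; apply: hmesh0; rewrite invr_gt0.
  by have := hem n n1; have := epsc n; rewrite ler_norml; lra.
have holdX w : signs (sample w) -> holder_on01 H L (X w).
  by move=> sw u t; apply: hL => n k; exact: (sw (Tagged (fun n => 'I_(2 ^ n)) k)).
have V_le n w : (1 <= n)%N -> signs (sample w) -> V n w <= L `^ p.
  move=> n1 sw; apply: power_variation_holder_le_pow => //; [exact: holdX|exact: hpi].
set K : R := 2 * (H^-1 * L `^ (H^-1 - 1)).
(* The summand 1 keeps the variance bound positive when L = 0. *)
set CV := K ^+ 2 * C + 1.
have CV0 : 0 < CV by rewrite ltr_wpDl// mulr_ge0 ?sqr_ge0 ?ltW.
have tail (t : R) : 0 < t -> \forall n \near \oo,
    (P [set w | t <= `|F n (sample w) - m n|]%R <= (2 * n%:R ^- 2)%:E)%E.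
  move=> t0; near=> n.
  have n1 : (1 <= n)%N by near: n; exact: nbhs_infty_ge.
  have ln1 : 1 <= ln n%:R :> R by near: n; exact: near_ln_ge1.
  have ln0 : 0 < ln n%:R :> R by apply: lt_le_trans ln1.
  have hs := hpi n n1.
  (* This choice makes the exponent t^2 / (2 W) at least 2 ln n. *)
  set a := t ^+ 2 / (4 * CV).
  have hk : mesh (pi n) `^ kappa <= a / ln n%:R.
    near: n; apply: near_mesh_powR_le => //.
    by rewrite divr_gt0 ?exprn_gt0 ?mulr_gt0.
  have mk0 : 0 < mesh (pi n) `^ kappa by rewrite powR_gt0// mesh_gt0.
  set W := CV * mesh (pi n) `^ kappa.
  have W0 : 0 < W by rewrite mulr_gt0.
  have := two_sided_tail_le rad' indep (nodes_uniq (Nf n)) sf0 (mF n) (dF n)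
    (D := fun j => K * influence H (pi n) j) (V := W) (t := t).
  move=> /(_ _ W0 _ t0) h; apply: le_trans (h _ _) _.
  - move=> j; rewrite mem_nodes => jN.
    apply: partial_tl_bounded_difference => // f sf.
    exact: partial_tl_holder.
  - under eq_bigr do rewrite exprMn.
    rewrite -mulr_sumr; apply: (@le_trans _ _ (K ^+ 2 * (C * mesh (pi n) `^ kappa))).
      by rewrite ler_wpM2l ?sqr_ge0// hC.
    by rewrite mulrA /W /CV ler_pM2r// lerDl.
  rewrite lee_fin ler_pM2l//.
  have -> : n%:R ^- 2 = expR (- (2 * ln n%:R)) :> R.
    rewrite expRN mulr_natl mulr2n expRD lnK ?posrE ?ltr0n//.
  rewrite ler_expR lerN2 ler_pdivlMr ?mulr_gt0//.
  apply: (@le_trans _ _ (2 * ln n%:R * (2 * (CV * (a / ln n%:R))))).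
    by rewrite ler_pM2l ?mulr_gt0// ler_pM2l// ler_pM2l.
  rewrite le_eqVlt; apply/orP; left; apply/eqP; rewrite /a.
  by field; rewrite !gt_eqF.
have bc : \forall w \ae P, forall k : nat, \forall n \near \oo,
    `|F n (sample w) - m n| < k.+1%:R^-1.
  apply: ae_foralln => k.
  have := @ae_near_notin _ _ _ P
    (fun n => [set w | k.+1%:R^-1 <= `|F n (sample w) - m n|]).
  move=> /(_ _ (tail _ _)) h; apply: filterS (h _ _).
  - by move=> w; apply: filterS => n /= /negP; rewrite -ltNge.
  - move=> n; apply: measurable_le_set => //; apply: measurableT_comp => //.
    by apply: measurable_funB => //; exact: mF.
  - by rewrite invr_gt0.
have dev : \forall w \ae P, signs (sample w) /\
    forall x, 0 < x -> \forall n \near \oo, `|V n w - e n| <= x.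
  apply: filterS2 good bc => w sw hw; split => // x x0.
  have [k kx] : exists k : nat, k.+1%:R^-1 <= x / 3.
    exists (Num.truncn (x / 3)^-1); have x30 : 0 < x / 3 by rewrite divr_gt0.
    rewrite -[leRHS]invrK lef_pV2 ?posrE ?invr_gt0//.
    have /andP[_ /ltW//] : (Num.truncn (x / 3)^-1)%:R <= (x / 3)^-1 <
      (Num.truncn (x / 3)^-1).+1%:R by apply: truncn_itv; rewrite invr_ge0 ltW.
  near=> n; have n1 : (1 <= n)%N by near: n; exact: nbhs_infty_ge.
  have nk : n.+1%:R^-1 <= k.+1%:R^-1 :> R.
    rewrite lef_pV2 ?posrE// ler_nat ltnS; near: n; exact: nbhs_infty_ge.
  have h1 := hV n w n1 sw; have h2 := hem n n1.
  have h3 := le_trans (le_trans (epsn n) nk) kx.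
  have h4 : `|F n (sample w) - m n| <= x / 3.
    by apply: le_trans kx; apply: ltW; near: n; exact: hw.
  by move: h1 h2 h4; rewrite !ler_norml; lra.
have low : \forall w \ae P, \forall n \near \oo, c0 / 4 <= V n w.
  apply: filterS dev => w [sw hw]; near=> n.
  have h1 : c0 / 2 <= e n by near: n.
  have : `|V n w - e n| <= c0 / 4 by near: n; apply: hw; rewrite divr_gt0.
  by rewrite ler_norml; lra.
split.
- near=> n; have n1 : (1 <= n)%N by near: n; exact: nbhs_infty_ge.
  apply/andP; split.
    rewrite hE// lee_fin; have : c0 / 2 <= e n by near: n.
    by lra.
  rewrite -(expectation_cst P (L `^ p)) unlock; apply: ae_le_integral_measr => //.
  + by move=> w; rewrite lee_fin V0.
  + by move=> w; rewrite lee_fin powR_ge0.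
  + by apply/measurable_EFinP; exact: measurable_cst.
  + by apply: filterS good => w sw; rewrite lee_fin; exact: V_le.
- apply: filterS dev => w [sw hw].
  suff h : (V n w - e n)%:E @[n --> \oo] --> 0%:E.
    apply: cvg_trans h; apply: near_eq_cvg; near=> n.
    have n1 : (1 <= n)%N by near: n; exact: nbhs_infty_ge.
    by rewrite hE.
  apply: cvg_EFin; first by near=> n.
  apply/cvgrPdist_le => x x0; near=> n.
  by rewrite sub0r normrN; near: n; exact: hw.
- apply: filterS2 good low => w sw hw; split.
  + by apply: limn_einf_ge_near; apply: filterS hw => n; rewrite lee_fin.
  + exact: limn_einf_sup.
  + apply: limn_esup_le_near; near=> n; rewrite lee_fin; apply: V_le => //.
    by near: n; exact: nbhs_infty_ge.
- apply: filterS2 good low => w sw hw.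
  apply: (@variation_index_holder _ H L (c0 / 4)) => //; first by rewrite divr_gt0.
  exact: holdX.
Unshelve. all: by end_near. Qed.
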